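(* Let $N\ge 2$. For each $r\in(0,\infty)$ there exists a decreasing sequence $\{t_n\}_{n=1}^\infty\subset(0,1)$ converging to zero and belonging to $\ell^{r,\infty}(\mathbb{N})$ such that, for every $$s<s_0=\min\left\{\frac{r}{\frac{N+1}{N}r+1},\ \frac{N}{2(N+1)}\right\},$$ the maximal estimate $$\Bigl\|\sup_{n\in\mathbb{N}}|e^{it_n\Delta}f|\Bigr\|_{L^2(B(0,1))}\le C\|f\|_{H^s(\mathbb{R}^N)}\qquad\text{for all } f\in H^s(\mathbb{R}^N)$$ fails, i.e. it does not hold for any constant $C$ independent of $f$.
   Context: For $t\in\mathbb{R}$, $e^{it\Delta}f(x)=\int_{\mathbb{R}^N}e^{ix\cdot\xi+it|\xi|^2}\hat f(\xi)\,d\xi$, with $\hat f$ the Fourier transform of $f$ (normalized so that $t=0$ gives $f$; for $f\in L^2$ the integral is understood as the usual $L^2$ extension). $B(0,1)$ is the unit ball of $\mathbb{R}^N$ centered at the origin. $H^s(\mathbb{R}^N)$ is the usual inhomogeneous $L^2$-based Sobolev space. For $0<r<\infty$, a sequence $\{t_n\}$ belongs to $\ell^{r,\infty}(\mathbb{N})$ if $\sup_{b>0}b^r\,\sharp\{n\in\mathbb{N}:t_n>b\}<\infty$, where $\sharp$ denotes cardinality. *)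

(* Defs.v *)
From HB Require Import structures.
From mathcomp.real_closed Require Export complex.
From mathcomp Require Export all_boot all_order all_algebra.
From mathcomp Require Export all_classical all_reals all_analysis.

Set Implicit Arguments.
Unset Strict Implicit.
Unset Printing Implicit Defensive.

Export Order.TTheory GRing.Theory Num.Theory.
Export numFieldNormedType.Exports.

Local Open Scope classical_set_scope.
Local Open Scope ring_scope.
Local Open Scope complex_scope.

Definition Rn (R : realType) (n : nat) := n.-tuple (measurableTypeR R).

Section LebesgueMeasure.
Variable R : realType.
Notation Rn := (Rn R).

Definition consRn n (p : measurableTypeR R * Rn n) : Rn n.+1 :=
  [tuple of p.1 :: p.2].

Lemma measurable_consRn n : measurable_fun [set: _] (@consRn n).
Proof. by apply: measurable_cons; [exact: measurable_fst|exact: measurable_snd]. Qed.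

Section Step.
Variables (n : nat) (mu : {sigma_finite_measure set (Rn n) -> \bar R}).

Definition lebesgue_cons : set (Rn n.+1) -> \bar R :=
  pushforward (@lebesgue_measure R \x mu)%E (@consRn n).

Let lebesgue_cons_measure : {measure set (Rn n.+1) -> \bar R} :=
  measure_function_pushforward__canonical__measure_function_Measure
    (@lebesgue_measure R \x mu)%E (measurable_consRn (n:=n)).

HB.instance Definition _ := Measure.copy lebesgue_cons lebesgue_cons_measure.

Let lebesgue_cons_sigma_finite : sigma_finite setT lebesgue_cons.
Proof.
have /sigma_finiteP[F [FT ndF Foo]] := sigma_finiteT (@lebesgue_measure R).
have /sigma_finiteP[G [GT ndG Goo]] := sigma_finiteT mu.
pose un (x : Rn n.+1) : measurableTypeR R * Rn n :=
  (thead x, [tuple of behead x]).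
have unK x : consRn (un x) = x by rewrite [RHS]tuple_eta.
have consK p : un (consRn p) = p.
  by case: p => a t; rewrite /un /consRn /= theadE; congr pair; exact/val_inj.
have mun : measurable_fun setT un.
  apply/measurable_fun_pairP; split => /=.
    exact: measurable_tnth.
  exact: measurable_behead.
exists (fun k => un @^-1` (F k `*` G k)).
  rewrite -preimage_bigcup -[LHS](preimage_setT un); congr (_ @^-1` _).
  rewrite -setXTT FT GT predeqE => -[x y]; split=> [[/=[i _ Fx] [j _ Gy]]|].
    exists (maxn i j) => //; split.
    - by move: x Fx; exact/subsetPset/ndF/leq_maxl.
    - by move: y Gy; exact/subsetPset/ndG/leq_maxr.
  by move=> [k _ []/= ? ?]; split; exists k.
move=> k; have [mF Fk] := Foo k; have [mG Gk] := Goo k; split.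
  by rewrite -[X in measurable X]setTI; apply: mun => //; exact: measurableX.
rewrite /lebesgue_cons /pushforward -comp_preimage.
rewrite (_ : un \o _ = idfun); last by apply/funext => p /=; rewrite consK.
by rewrite preimage_id product_measure1E// lte_mul_pinfty// ge0_fin_numE.
Qed.

HB.instance Definition _ :=
  Measure_isSigmaFinite.Build _ _ _ lebesgue_cons lebesgue_cons_sigma_finite.

End Step.

Fixpoint lebesgueRn (n : nat) : {sigma_finite_measure set (Rn n) -> \bar R} :=
  if n is m.+1 then lebesgue_cons (lebesgueRn m) else \d_ ([tuple] : Rn 0).

End LebesgueMeasure.

Lemma lebesgueRn_box (R : realType) n (A : 'I_n -> set (measurableTypeR R)) :
  (forall i, measurable (A i)) ->
  lebesgueRn R n [set x | forall i, A i (tnth x i)] =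
  (\prod_(i < n) lebesgue_measure (A i))%E.
Proof.
elim: n A => [|n IH] A mA.
  rewrite big_ord0 /= /dirac /= indicE mem_set//= => -[//].
rewrite big_ord_recl -IH; last by move=> i; exact: mA.
rewrite /= /lebesgue_cons /pushforward.
rewrite (_ : _ @^-1` _ =
    A ord0 `*` [set x : Rn R n | forall i, A (lift ord0 i) (tnth x i)]).
  rewrite product_measure1E//.
  rewrite (_ : [set _ | _] = \bigcap_(i in [set: 'I_n])
     (fun x : Rn R n => tnth x i) @^-1` A (lift ord0 i)).
    apply: fin_bigcap_measurable => // i _.
    by rewrite -[X in measurable X]setTI; exact: measurable_tnth.
  by apply/seteqP; split => x /= Hx i; [move=> _|]; exact: Hx.
apply/seteqP; split => -[a x] /=.
  by move=> H; split; [exact: (H ord0)|move=> i; have := H (lift ord0 i); rewrite tnthS].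
move=> [H0 H] i; have [j ->|->] := unliftP ord0 i; last exact: H0.
by rewrite tnthS; exact: H.
Qed.

Section Schrodinger.
Variables (R : realType) (N : nat).
Notation RN := (Rn R N).
Notation mu := (lebesgueRn R N).
Notation normc := Normc.normc.
Notation Re := complex.Re.
Notation Im := complex.Im.
Implicit Types (f g u : RN -> R[i]) (x xi : RN).

Definition dotRn x xi : R := \sum_(i < N) tnth x i * tnth xi i.

Definition unit_ball : set RN := [set x | dotRn x x < 1].

Definition expi (a : R) : R[i] := cos a +i* sin a.

Definition integralC f : R[i] :=
  (\int[mu]_x Re (f x)) +i* (\int[mu]_x Im (f x)).

Definition measurableC f :=
  measurable_fun setT (fun x => Re (f x)) /\
  measurable_fun setT (fun x => Im (f x)).

Definition LnormC (p : R) f : \bar R :=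
  Lnorm mu p%:E (fun x => (normc (f x))%:E).

Definition inLp (p : R) f := measurableC f /\ (LnormC p f < +oo)%E.

Definition L2_cvg (f_ : nat -> RN -> R[i]) f :=
  LnormC 2 (fun x => f_ k x - f x) @[k --> \oo] --> 0%E.

(* [L2_extension T f g]: [g] is a representative of the value at [f] of the
   extension of [T] from L^1 \cap L^2 to L^2, i.e. (f, g) is in the closure in
   L^2 x L^2 of the graph of [T]. Only applied below to operators [T] that are
   multiples of L^2 isometries by Plancherel, whose closure is a.e. unique. *)
Definition L2_extension (T : (RN -> R[i]) -> RN -> R[i]) f g :=
  [/\ inLp 2 f, inLp 2 g &
      exists f_ : nat -> RN -> R[i],
        [/\ forall k, inLp 1 (f_ k) /\ inLp 2 (f_ k),
            L2_cvg f_ f &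
            L2_cvg (fun k => T (f_ k)) g]].

(* The factor (2 pi)^-N makes the unnormalized [schrodinger_int 0] the inverse
   of [fourier_int]. *)
Definition fourier_int f : RN -> R[i] := fun xi =>
  ((2 * pi) ^- N)%:C * integralC (fun x => expi (- dotRn x xi) * f x).

Definition schrodinger_int (t : R) g : RN -> R[i] := fun x =>
  integralC (fun xi => expi (dotRn x xi + t * dotRn xi xi) * g xi).

Definition is_fourier f fh := L2_extension fourier_int f fh.

Definition is_schrodinger (t : R) f u :=
  exists fh, is_fourier f fh /\ L2_extension (schrodinger_int t) fh u.

(* The H^s norm in terms of the Fourier transform [fh] of the function. *)
Definition sobolev_norm (s : R) fh : \bar R :=
  Lnorm mu 2%:E (fun xi => ((1 + dotRn xi xi) `^ (s / 2) * normc (fh xi))%:E).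

(* For s >= 0 the functions [f] quantified over form exactly H^s (R^N); for
   s < 0 they form the dense subspace L^2 \cap H^s, on which e^{it Delta} f is
   a function. The [u n] are arbitrary representatives of e^{i t_n Delta} f. *)
Definition maximal_estimate (t : nat -> R) (s C : R) :=
  forall (f fh : RN -> R[i]) (u : nat -> RN -> R[i]),
    is_fourier f fh -> (sobolev_norm s fh < +oo)%E ->
    (forall n, is_schrodinger (t n) f (u n)) ->
    (Lnorm mu 2%:E
       ((fun x => ereal_sup [set (normc (u n x))%:E | n in setT]) \_ unit_ball)
     <= C%:E * sobolev_norm s fh)%E.

End Schrodinger.

Definition weak_lr (R : realType) (r : R) (t : nat -> R) :=
  (ereal_sup [set (b `^ r)%R%:E * counting [set n | (b < t n)%R]
             | b in [set b : R | (0 < b)%R]] < +oo)%E.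

(* Main.v *)
(* A Gaussian variant of Bourgain's example, built so that its focusing sets at
   different times are disjoint. Put K = 2^k, Q = K^N; l0 is a constant times a power of K.
   In the first coordinate the datum is one Gaussian packet, moving with large
   velocity; in the coordinate i > 0 it is a sum of K packets with frequencies
   th_i + L m, m < K. At the times t with t L^2 in 2 pi Z the K packets are all
   in phase near the points of a lattice of step 2 pi / L, translated by
   - 2 t th_i (Galilean invariance). With th_i = L / (2 K^i), the translation
   vector encodes the base-K digits of the integer t L^2 / (2 pi), and the motion
   of the first packet bounds the differences of these integers, so the focusing
   sets of Q^2 consecutive times are pairwise disjoint. Each of them carries a
   fixed proportion of the L^2 mass, hence the maximal function gains the factor
   Q^2 = K^(2N) in squared norm, while the frequencies are at most
   2 pi K^(2N+2) l0. The choice of l0 puts these times in l^{r,oo}; the sequence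
   is the concatenation of the blocks for k = 0, 1, 2, ... *)
Require Import Defs.
From mathcomp Require Import measurable_realfun ring lra.

Set Implicit Arguments.
Unset Strict Implicit.
Unset Printing Implicit Defensive.

Local Open Scope classical_set_scope.
Local Open Scope ring_scope.
Local Open Scope complex_scope.

Local Notation normc := Normc.normc.
Local Notation Re := complex.Re.
Local Notation Im := complex.Im.

(** * Complex-valued integrals and tensor products *)

(** Gaussians make the counterexample explicit: they stay Gaussian under the evolution, tensor
    products reduce everything to one variable, and datum, transform and evolution all lie in L^1
    and L^2, so that no density argument is needed. The price is that the summands of a packet
    overlap in frequency; their spacing is taken large enough for almost orthogonality. The
    exponents come from two demands on l0 = const * K^slack. The disjoint focusing sets turn the
    maximal estimate into K^(2N) <= C' (K^(2N+2) l0)^(2s), which for s > 0 fails for large K when s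
    < N / (2N + 2 + slack). On the other side, block k contains about K^(2N) times of size K^(-2N-2)
    l0^(-2), so l^{r,oo} asks for slack >= N / r - (N + 1). The smallest nonnegative slack meeting
    this turns the first threshold into s_0, the cases slack > 0 and slack = 0 producing the two
    entries of the minimum. Neither the times nor the data depend on s or C, so one sequence defeats
    every s < s_0 at once. *)

Section ComplexIntegral.
Variables (d : measure_display) (T : measurableType d) (R : realType).
Variable mu : {measure set T -> \bar R}.
Implicit Types (f g : T -> R[i]) (z : R[i]).

Definition integrableC f :=
  mu.-integrable setT (EFin \o (fun x => Re (f x))) /\
  mu.-integrable setT (EFin \o (fun x => Im (f x))).

Definition intC f : R[i] :=
  (\int[mu]_x Re (f x)) +i* (\int[mu]_x Im (f x)).

Lemma integrableCD f g : integrableC f -> integrableC g ->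
  integrableC (fun x => f x + g x).
Proof.
move=> [fr fi] [gr gi]; split.
  rewrite (_ : _ \o _ = ((EFin \o (fun x => Re (f x))) \+ (EFin \o (fun x => Re (g x))))%E).
    exact: integrableD.
  by apply/funext => x /=; case: (f x) (g x) => a b [a' b'].
rewrite (_ : _ \o _ = ((EFin \o (fun x => Im (f x))) \+ (EFin \o (fun x => Im (g x))))%E).
  exact: integrableD.
by apply/funext => x /=; case: (f x) (g x) => a b [a' b'].
Qed.

Lemma intCD f g : integrableC f -> integrableC g ->
  intC (fun x => f x + g x) = intC f + intC g.
Proof.
move=> [fr fi] [gr gi]; rewrite /intC.
rewrite [RHS]/GRing.add/= -RintegralD// -RintegralD//.
by congr (_ +i* _); apply: eq_Rintegral => x _; case: (f x) (g x) => a b [a' b'].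
Qed.

Let integrable_lin (u v : T -> R) (a b : R) :
  mu.-integrable setT (EFin \o u) -> mu.-integrable setT (EFin \o v) ->
  mu.-integrable setT (EFin \o (fun x => a * u x + b * v x)).
Proof.
move=> iu iv.
rewrite (_ : _ \o _ = ((EFin \o (fun x => a * u x)%R) \+ (EFin \o (fun x => b * v x)%R))%E)//.
by apply: integrableD => //; [have := integrableZl measurableT a iu
  |have := integrableZl measurableT b iv].
Qed.

Let Rintegral_lin (u v : T -> R) (a b : R) :
  mu.-integrable setT (EFin \o u) -> mu.-integrable setT (EFin \o v) ->
  \int[mu]_x (a * u x + b * v x) = a * (\int[mu]_x u x) + b * (\int[mu]_x v x).
Proof.
move=> iu iv.
rewrite RintegralD ?RintegralZl//.
  by have := integrableZl measurableT a iu.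
by have := integrableZl measurableT b iv.
Qed.

Lemma integrableCZ z f : integrableC f -> integrableC (fun x => z * f x).
Proof.
case: z => a b [fr fi]; split.
  rewrite (_ : _ \o _ = EFin \o (fun x => a * Re (f x) + (- b) * Im (f x))).
    exact: integrable_lin.
  by apply/funext => x /=; case: (f x) => u v /=; rewrite mulNr.
rewrite (_ : _ \o _ = EFin \o (fun x => b * Re (f x) + a * Im (f x))).
  exact: integrable_lin.
by apply/funext => x /=; case: (f x) => u v /=; rewrite addrC.
Qed.

Lemma intCZ z f : integrableC f -> intC (fun x => z * f x) = z * intC f.
Proof.
case: z => a b [fr fi]; rewrite /intC.
rewrite [RHS]/GRing.mul/= -mulNr -Rintegral_lin// [X in _ = _ +i* X]addrC -Rintegral_lin//.
congr (_ +i* _); apply: eq_Rintegral => x _; case: (f x) => u v /=.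
  by rewrite mulNr.
by rewrite addrC.
Qed.

Lemma integrableC0 : integrableC (fun=> 0).
Proof. by split; exact: integrable0. Qed.

Lemma intC0 : intC (fun=> 0) = 0.
Proof. by rewrite /intC/= /Rintegral integral0. Qed.

Lemma integrableC_sum n (F : 'I_n -> T -> R[i]) :
  (forall i, integrableC (F i)) -> integrableC (fun x => \sum_(i < n) F i x).
Proof.
elim: n F => [|n IH] F iF.
  by under eq_fun do rewrite big_ord0; exact: integrableC0.
under eq_fun do rewrite big_ord_recl.
by apply: integrableCD => //; exact: IH.
Qed.

Lemma intC_sum n (F : 'I_n -> T -> R[i]) :
  (forall i, integrableC (F i)) ->
  intC (fun x => \sum_(i < n) F i x) = \sum_(i < n) intC (F i).
Proof.
elim: n F => [|n IH] F iF.
  by under eq_fun do rewrite big_ord0; rewrite intC0 big_ord0.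
under eq_fun do rewrite big_ord_recl.
by rewrite intCD ?IH ?big_ord_recl//; exact: integrableC_sum.
Qed.

End ComplexIntegral.

(** * Fubini for products of functions, and induction on the dimension *)

Section RealProduct.
Context {d1 d2} {T1 : measurableType d1} {T2 : measurableType d2} {R : realType}.
Variables (m1 : {sigma_finite_measure set T1 -> \bar R})
          (m2 : {sigma_finite_measure set T2 -> \bar R}).

Lemma integrable_prodM (f : T1 -> R) (g : T2 -> R) :
  m1.-integrable setT (EFin \o f) -> m2.-integrable setT (EFin \o g) ->
  (m1 \x m2)%E.-integrable setT (EFin \o (fun z => f z.1 * g z.2)).
Proof.
move=> fi gi.
have mf : measurable_fun setT f.
  by apply/measurable_EFinP; exact: measurable_int fi.
have mg : measurable_fun setT g.
  by apply/measurable_EFinP; exact: measurable_int gi.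
apply/integrable12ltyP => /=.
  by apply/measurable_EFinP; apply: measurable_funM;
    apply: measurableT_comp.
have H x : (\int[m2]_y `|(f x * g y)%:E| = `|f x|%:E * \int[m2]_y `|(g y)%:E|)%E.
  rewrite -ge0_integralZl//; last first.
    by apply/measurable_EFinP; exact: measurableT_comp.
  by apply: eq_integral => y _; rewrite abse_EFin normrM EFinM.
under eq_integral do rewrite H.
move/integrableP : gi => [_ gi].
rewrite ge0_integralZr ?integral_ge0//=.
  apply: lte_mul_pinfty => //; first exact: integral_ge0.
    by move/integrableP : fi => [_ fi]; rewrite ge0_fin_numE ?integral_ge0.
by apply/measurable_EFinP; exact: measurableT_comp.
Qed.

Lemma Rintegral_prodM (f : T1 -> R) (g : T2 -> R) :
  m1.-integrable setT (EFin \o f) -> m2.-integrable setT (EFin \o g) ->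
  \int[(m1 \x m2)%E]_z (f z.1 * g z.2) = (\int[m1]_x f x) * \int[m2]_y g y.
Proof.
move=> fi gi.
rewrite /Rintegral -integral12_prod_meas1; last exact: integrable_prodM.
rewrite /fubini_F/=.
have -> : (\int[m1]_x \int[m2]_y (f x * g y)%:E =
    \int[m1]_x ((f x)%:E * (\int[m2]_y g y)%R%:E))%E.
  apply: eq_integral => x _.
  under eq_integral do rewrite EFinM.
  rewrite integralZl//; congr (_ * _)%E.
  by rewrite fineK//; exact: integrable_fin_num.
rewrite integralZr// fineM//.
by have := integrable_fin_num measurableT fi.
Qed.

End RealProduct.

Section RnInduction.
Variables (R : realType) (n : nat).
Notation leb := (@lebesgue_measure R).
Notation muS := (lebesgueRn R n.+1).
Notation mun := (lebesgueRn R n).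

Lemma integral_lebesgueRnS (f : Rn R n.+1 -> \bar R) :
  measurable_fun setT f -> (forall x, 0 <= f x)%E ->
  (\int[muS]_x f x = \int[(leb \x mun)%E]_z f (consRn z))%E.
Proof.
move=> mf f0.
have := ge0_integral_pushforward (@measurable_consRn R n) (leb \x mun)%E measurableT mf
    (fun x _ => f0 x).
rewrite preimage_setT => <-.
by apply: eq_measure_integral; first exact: measurable_consRn.
Qed.

Lemma integrable_lebesgueRnS (f : Rn R n.+1 -> R) :
  measurable_fun setT f ->
  muS.-integrable setT (EFin \o f) <->
  (leb \x mun)%E.-integrable setT (EFin \o (fun z => f (consRn z))).
Proof.
move=> mf.
have mg : measurable_fun setT (fun z => f (consRn z)).
  by apply: measurableT_comp => //; exact: measurable_consRn.
split=> /integrableP[_ H]; apply/integrableP; split;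
  try exact/measurable_EFinP.
  rewrite integral_lebesgueRnS// in H.
  by apply: measurableT_comp => //; exact/measurable_EFinP.
rewrite integral_lebesgueRnS//.
by apply: measurableT_comp => //; exact/measurable_EFinP.
Qed.

Lemma Rintegral_lebesgueRnS (f : Rn R n.+1 -> R) :
  measurable_fun setT f ->
  (leb \x mun)%E.-integrable setT (EFin \o (fun z => f (consRn z))) ->
  \int[muS]_x f x = \int[(leb \x mun)%E]_z f (consRn z).
Proof.
move=> mf fi; rewrite /Rintegral; congr fine.
have := @integral_pushforward _ _ _ _ _ _ (@measurable_consRn R n) (leb \x mun)%E setT
    (EFin \o f).
rewrite preimage_setT => <-//; last exact/measurable_EFinP.
Qed.

End RnInduction.

Lemma prodC_consRn (R : realType) n (h : 'I_n.+1 -> R -> R[i]) z :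
  \prod_(i < n.+1) h i (tnth (consRn z) i) =
  h ord0 z.1 * \prod_(i < n) h (lift ord0 i) (tnth z.2 i).
Proof.
rewrite big_ord_recl /consRn; congr (_ * _).
by apply: eq_bigr => i _; rewrite tnthS.
Qed.

Section TensorProduct.
Variable R : realType.
Notation leb := (@lebesgue_measure R).

Definition cmeasurable d (T : measurableType d) (f : T -> R[i]) :=
  measurable_fun setT (fun x => Re (f x)) /\
  measurable_fun setT (fun x => Im (f x)).

Lemma integrableC_measurable d (T : measurableType d)
    (mu : {measure set T -> \bar R}) f : integrableC mu f -> cmeasurable f.
Proof.
by move=> [/measurable_int/measurable_EFinP ? /measurable_int/measurable_EFinP].
Qed.

Lemma cmeasurableM d (T : measurableType d) (f g : T -> R[i]) :
  cmeasurable f -> cmeasurable g -> cmeasurable (fun x => f x * g x).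
Proof.
move=> [fr fi] [gr gi]; split.
  rewrite (_ : (fun _ => _) = (fun x => Re (f x) * Re (g x) - Im (f x) * Im (g x))).
    by apply: measurable_funB; exact: measurable_funM.
  by apply/funext => x; case: (f x) (g x) => a b [].
rewrite (_ : (fun _ => _) = (fun x => Re (f x) * Im (g x) + Im (f x) * Re (g x))).
  by apply: measurable_funD; exact: measurable_funM.
by apply/funext => x; case: (f x) (g x) => a b [].
Qed.

Lemma cmeasurable_tensor n (h : 'I_n -> R -> R[i]) :
  (forall i, cmeasurable (h i : measurableTypeR R -> R[i])) ->
  cmeasurable (fun x : Rn R n => \prod_(i < n) h i (tnth x i)).
Proof.
move=> mh.
suff H (s : seq 'I_n) : cmeasurable (fun x : Rn R n => \prod_(i <- s) h i (tnth x i)).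
  exact: H.
elim: s => [|i s IH].
  by split; under eq_fun do rewrite big_nil; exact: measurable_cst.
under eq_fun do rewrite big_cons.
apply: cmeasurableM IH; have [mr mi] := mh i.
by split; [apply: (measurableT_comp mr)|apply: (measurableT_comp mi)];
  exact: measurable_tnth.
Qed.

(** Fubini in the first coordinate and induction on [n]. Integrals are defined through real and
    imaginary parts, so the complex product is expanded into four real products, each treated by
    [Rintegral_prodM]. The Fourier, evolution and mass integrals below are all reduced to one
    variable this way. *)
Lemma intC_tensor n (h : 'I_n -> R -> R[i]) :
  (forall i, integrableC leb (h i)) ->
  integrableC (lebesgueRn R n) (fun x => \prod_(i < n) h i (tnth x i)) /\
  intC (lebesgueRn R n) (fun x => \prod_(i < n) h i (tnth x i)) =
  \prod_(i < n) intC leb (h i).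
Proof.
elim: n h => [|n IH] h ih.
  have -> : (fun x => \prod_(i < 0) h i (tnth x i)) = (fun=> 1).
    by apply/funext => x; rewrite big_ord0.
  rewrite big_ord0; split.
    by split; exact: finite_measure_integrable_cst.
  by rewrite /intC !Rintegral_cst//= /dirac/= indicT mulr1 mul0r.
have mprod := cmeasurable_tensor (fun i => integrableC_measurable (ih i)).
have [[IHr IHi] IHE] := IH _ (fun i => ih (lift ord0 i)).
have [hr hi] := ih ord0.
set H := (fun x : Rn R n => \prod_(i < n) _) in IHr IHi IHE.
have ReE z : Re (\prod_(i < n.+1) h i (tnth (consRn z) i)) =
    Re (h ord0 z.1) * Re (H z.2) - Im (h ord0 z.1) * Im (H z.2).
  by rewrite prodC_consRn -/(H z.2); case: (h _ _) (H _) => a b [].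
have ImE z : Im (\prod_(i < n.+1) h i (tnth (consRn z) i)) =
    Re (h ord0 z.1) * Im (H z.2) + Im (h ord0 z.1) * Re (H z.2).
  by rewrite prodC_consRn -/(H z.2); case: (h _ _) (H _) => a b [].
have rr := integrable_prodM hr IHr; have ii := integrable_prodM hi IHi.
have ri := integrable_prodM hr IHi; have ir := integrable_prodM hi IHr.
have iRe : (leb \x lebesgueRn R n)%E.-integrable setT
    (EFin \o (fun z => Re (\prod_(i < n.+1) h i (tnth (consRn z) i)))).
  rewrite (_ : _ \o _ = (fun z =>
      ((Re (h ord0 z.1) * Re (H z.2))%:E - (Im (h ord0 z.1) * Im (H z.2))%:E)%E)).
    exact: integrableB.
  by apply/funext => z; rewrite /= ReE EFinB.
have iIm : (leb \x lebesgueRn R n)%E.-integrable setT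
    (EFin \o (fun z => Im (\prod_(i < n.+1) h i (tnth (consRn z) i)))).
  rewrite (_ : _ \o _ = (fun z =>
      ((Re (h ord0 z.1) * Im (H z.2))%:E + (Im (h ord0 z.1) * Re (H z.2))%:E)%E)).
    exact: integrableD.
  by apply/funext => z; rewrite /= ImE EFinD.
split.
  by split; apply/integrable_lebesgueRnS => //; [exact: mprod.1|exact: mprod.2].
rewrite big_ord_recl -IHE /intC.
rewrite !Rintegral_lebesgueRnS//; [|exact: mprod.2|exact: mprod.1].
under eq_Rintegral do rewrite ReE.
under [in X in _ +i* X]eq_Rintegral do rewrite ImE.
rewrite RintegralB// RintegralD//.
rewrite (Rintegral_prodM hr IHr) (Rintegral_prodM hi IHi) (Rintegral_prodM hr IHi)
    (Rintegral_prodM hi IHr).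
by rewrite [X in _ = _ +i* X]addrC addrC [in X in X +i* _]addrC [in X in _ +i* X]addrC.
Qed.

End TensorProduct.

(** * Gaussians *)

Section Gaussian.
Variable R : realType.
Notation leb := (@lebesgue_measure R).
Implicit Types (a t w x y : R).

Definition gauss a w x : R := expR (- a * (x - w) ^+ 2).

Lemma gauss_ge0 a w x : 0 <= gauss a w x. Proof. exact: expR_ge0. Qed.

Lemma continuous_is_derive (f df : R -> R) :
  (forall x, is_derive x 1 f (df x)) -> continuous f.
Proof.
move=> h x; apply: differentiable_continuous; apply/derivable1_diffP.
exact: (@ex_derive _ _ _ _ _ _ _ (h x)).
Qed.

Lemma is_derive_gauss a w x :
  is_derive x 1 (gauss a w) (- 2 * a * (x - w) * gauss a w x).
Proof.
apply: is_derive_eq; rewrite /gauss/= /GRing.scale/= ; ring.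
Qed.

Lemma continuous_gauss a w : continuous (gauss a w).
Proof. by move=> x; apply: (continuous_is_derive (is_derive_gauss a w)). Qed.

Lemma measurable_gauss a w : measurable_fun setT (gauss a w).
Proof. by apply: continuous_measurable_fun; exact: continuous_gauss. Qed.

Lemma gauss_normal a w x : 0 < a ->
  gauss a w x = Num.sqrt (pi / a) * normal_pdf w (Num.sqrt ((2 * a)^-1)) x.
Proof.
move=> a0; have s0 : 0 < Num.sqrt ((2 * a)^-1) by rewrite sqrtr_gt0 invr_gt0; lra.
rewrite normal_pdfE ?gt_eqF//= /normal_peak /normal_fun.
rewrite sqr_sqrtr; last by rewrite invr_ge0; lra.
have -> : (2 * a)^-1 * pi *+ 2 = pi / a :> R.
  by rewrite -mulr_natr; field; rewrite gt_eqF.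
rewrite mulrA divff ?mul1r; last by rewrite gt_eqF// sqrtr_gt0 divr_gt0// pi_gt0.
by rewrite /gauss; congr expR; rewrite -mulr_natr; field; rewrite gt_eqF.
Qed.

Lemma integrable_gauss a w : 0 < a -> leb.-integrable setT (EFin \o gauss a w).
Proof.
move=> a0.
rewrite (_ : _ \o _ = (fun x =>
    ((Num.sqrt (pi / a))%:E * (normal_pdf w (Num.sqrt ((2 * a)^-1)) x)%:E)%E)).
  by apply: integrableZl => //; exact: integrable_normal_pdf.
by apply/funext => x; rewrite /= gauss_normal.
Qed.

Lemma integral_gauss a w : 0 < a -> \int[leb]_x gauss a w x = Num.sqrt (pi / a).
Proof.
move=> a0; under eq_Rintegral do rewrite gauss_normal//.
rewrite RintegralZl//; last exact: integrable_normal_pdf.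
by rewrite /Rintegral integral_normal_pdf mulr1.
Qed.

(** One condition that yields both integrability and vanishing at infinity. The centre is fixed at 0
    and the rate [c] is free, which makes the class stable under sums, products and translations; a
    shifted Gaussian enters it at half its rate. *)
Definition gdominated (f : R -> R) :=
  measurable_fun setT f /\
  exists C c, [/\ 0 <= C, 0 < c & forall x, `|f x| <= C * gauss c 0 x].

Lemma gauss_recenter c w x : 0 < c ->
  gauss c w x <= expR (c * w ^+ 2) * gauss (c / 2) 0 x.
Proof.
move=> c0; rewrite /gauss -expRD ler_expR -subr_ge0.
rewrite (_ : _ - _ = c / 2 * (x - 2 * w) ^+ 2); last by field.
by rewrite mulr_ge0 ?sqr_ge0// divr_ge0// ltW.
Qed.

Lemma gdominatedZ k f : gdominated f -> gdominated (fun x => k * f x).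
Proof.
move=> [mf [C [c [C0 c0 fC]]]]; split; first exact: measurable_funM.
exists (`|k| * C), c; split => //; first by rewrite mulr_ge0.
by move=> x; rewrite normrM -mulrA ler_wpM2l.
Qed.

Lemma gdominatedD f g : gdominated f -> gdominated g ->
  gdominated (fun x => f x + g x).
Proof.
move=> [mf [C [c [C0 c0 fC]]]] [mg [D [d [D0 d0 gD]]]].
split; first exact: measurable_funD.
exists (C + D), (Num.min c d); split; [exact: addr_ge0|by rewrite lt_min c0|move=> x].
rewrite mulrDl (le_trans (ler_normD _ _))// lerD//.
  rewrite (le_trans (fC x))// ler_wpM2l// ler_expR ler_wpM2r ?sqr_ge0//.
  by rewrite lerN2 ge_min lexx.
rewrite (le_trans (gD x))// ler_wpM2l// ler_expR ler_wpM2r ?sqr_ge0//.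
by rewrite lerN2 ge_min lexx orbT.
Qed.

Lemma gdominated_sum n (F : 'I_n -> R -> R) : (forall i, gdominated (F i)) ->
  gdominated (fun x => \sum_(i < n) F i x).
Proof.
elim: n F => [|n IH] F dF.
  rewrite (_ : (fun _ => _) = cst 0); last by apply/funext => x; rewrite big_ord0.
  by split => //; exists 0, 1; split => // x; rewrite normr0 mul0r.
under eq_fun do rewrite big_ord_recl.
by apply: gdominatedD => //; exact: IH.
Qed.

Lemma gdominated_le (f g : R -> R) : measurable_fun setT f -> gdominated g ->
  (forall x, `|f x| <= `|g x|) -> gdominated f.
Proof.
move=> mf [_ [C [c [C0 c0 fC]]]] fg; split => //; exists C, c; split => // x.
exact: le_trans (fC x).
Qed.

Lemma gdominated_gauss c w : 0 < c -> gdominated (gauss c w).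
Proof.
move=> c0; split; first exact: measurable_gauss.
exists (expR (c * w ^+ 2)), (c / 2); split; rewrite ?expR_ge0 ?divr_gt0// => x.
by rewrite ger0_norm ?gauss_ge0 ?gauss_recenter.
Qed.

Lemma gdominated_integrable f : gdominated f -> leb.-integrable setT (EFin \o f).
Proof.
move=> [mf [C [c [C0 c0 fC]]]].
have := integrableZl measurableT C (integrable_gauss 0 c0).
apply: le_integrable => //; first exact/measurable_EFinP.
move=> x _; rewrite /= lee_fin (le_trans (fC x))// ger0_norm//.
by rewrite mulr_ge0// gauss_ge0.
Qed.

Lemma expRM_le1 x : 0 <= x -> x * expR (- x) <= 1.
Proof.
move=> x0; rewrite expRN ler_pdivrMr ?expR_gt0// mul1r.
by apply: le_trans (expR_ge1Dx x); rewrite lerDr.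
Qed.

(** Half of the exponent is spent on the quadratic factor, by u exp(-u) <= 1. *)
Lemma sqr_gauss_le a w x : 0 < a ->
  (x - w) ^+ 2 * gauss (2 * a) w x <= a^-1 * gauss a w x.
Proof.
move=> a0; rewrite /gauss.
have -> : - (2 * a) * (x - w) ^+ 2 = - (a * (x - w) ^+ 2) + (- a * (x - w) ^+ 2) by ring.
rewrite expRD mulrA ler_wpM2r ?expR_ge0//.
rewrite -[leRHS]mulr1 -ler_pdivrMl ?invr_gt0// invrK mulrA.
by rewrite expRM_le1// mulr_ge0 ?sqr_ge0// ltW.
Qed.

Lemma gauss_le_inv a w x : 0 < a -> gauss a w x <= (1 + a * (x - w) ^+ 2)^-1.
Proof.
move=> a0; rewrite /gauss mulNr expRN lef_pV2 ?posrE ?expR_gt0 ?expR_ge1Dx//.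
by rewrite ltr_pwDl// mulr_ge0 ?sqr_ge0// ltW.
Qed.

(* The hypotheses on F force it to vanish at both ends of the line. *)
Lemma integral_derive_eq0 (F f : R -> R) :
  (forall x, is_derive x 1 F (f x)) -> continuous f -> gdominated f ->
  gdominated F -> \int[leb]_x f x = 0.
Proof.
move=> dF cf df [_ [C [c [C0 c0 FC0]]]].
have [w FC] : exists w, forall x, `|F x| <= C * gauss c w x by exists 0.
have intf := gdominated_integrable df.
have mf := df.1.
pose I n : set R := `[- (n.+1%:R), n.+1%:R]%classic.
have mI n : measurable (I n) by exact: measurable_itv.
have F0 n : (\int[leb]_(x in I n) (f x)%:E = (F n.+1%:R)%:E - (F (- (n.+1%:R)))%:E)%E.
  apply: continuous_FTC2.
  - by rewrite gtrN.
  - exact: continuous_subspaceT.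
  - split=> [x _||].
    + exact: (@ex_derive _ _ _ _ _ _ _ (dF x)).
    + by apply: cvg_at_right_filter; exact: (continuous_is_derive dF).
    + by apply: cvg_at_left_filter; exact: (continuous_is_derive dF).
  - by move=> x _; rewrite derive1E (@derive_val _ _ _ _ _ _ _ (dF x)).
(* A rate 1/n at the endpoints is enough, so the Gaussian is weakened to 1 / (1 + c (x - w)^2). *)
have Fcvg (s : R) : `|s| = 1 -> F (s * n.+1%:R) @[n --> \oo] --> 0.
  move=> s1; apply: norm_cvg0.
  have s2 : s ^+ 2 = 1 by rewrite -real_normK ?num_real// s1 expr1n.
  apply: (@squeeze_cvgr _ _ _ _ (cst 0) (fun n =>
      (C * (1 + w ^+ 2 *+ 2 * c) * (2 / c)) * n.+1%:R^-1)).
  - apply: nearW => n; rewrite normr_ge0/= (le_trans (FC _))//.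
    rewrite -!mulrA ler_wpM2l//.
    apply: (le_trans (gauss_le_inv w (s * n.+1%:R) c0)).
    have n1 : 1 <= n.+1%:R :> R by rewrite ler1n.
    set m := n.+1%:R in n1 *.
    have key : m * (c / 2) <= (1 + w ^+ 2 *+ 2 * c) * (1 + c * (s * m - w) ^+ 2).
      have e1 : m ^+ 2 <= (s * m - w) ^+ 2 *+ 2 + w ^+ 2 *+ 2.
        rewrite -[m ^+ 2]mul1r -s2 -exprMn -subr_ge0.
        by rewrite (_ : _ - _ = (s * m - w - w) ^+ 2) ?sqr_ge0//; ring.
      have e2 : m <= m ^+ 2 by rewrite expr2 ler_peMl// (le_trans ler01).
      have cA : 0 <= c * (s * m - w) ^+ 2 by rewrite mulr_ge0 ?sqr_ge0// ltW.
      have cB : 0 <= c * w ^+ 2 by rewrite mulr_ge0 ?sqr_ge0// ltW.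
      have cAB := mulr_ge0 cA cB.
      have cm : c * m <= c * ((s * m - w) ^+ 2 *+ 2 + w ^+ 2 *+ 2).
        by rewrite ler_pM2l//; exact: le_trans e1.
      apply: (@le_trans _ _ (c * m / 2)); first by rewrite mulrA (mulrC m).
      rewrite ler_pdivrMr//; apply: (le_trans cm); rewrite -subr_ge0.
      rewrite (_ : _ - _ = 2 + 2 * (c * w ^+ 2) + 4 * (c * (s * m - w) ^+ 2 * (c * w ^+ 2)));
          last by ring.
      by rewrite !addr_ge0// mulr_ge0.
    have p0 : 0 < 1 + c * (s * m - w) ^+ 2.
      by rewrite ltr_pwDl// mulr_ge0 ?sqr_ge0// ltW.
    have m0 : 0 < m by apply: lt_le_trans n1.
    rewrite -div1r ler_pdivrMr//.
    rewrite [leRHS](_ : _ = (1 + w ^+ 2 *+ 2 * c) * (1 + c * (s * m - w) ^+ 2) / (m * (c / 2))).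
      by rewrite ler_pdivlMr ?mul1r// mulr_gt0// divr_gt0.
    by field; rewrite !gt_eqF.
  - exact: cvg_cst.
  - rewrite -[X in _ --> X](mulr0 (C * (1 + w ^+ 2 *+ 2 * c) * (2 / c))).
    by apply: cvgMr; exact: cvg_harmonic.
have Icvg : (\int[leb]_(x in I n) (f x)%:E)%E @[n --> \oo] --> 0%E.
  under eq_fun do rewrite F0 -EFinB.
  apply: cvg_EFin; first exact: nearW.
  rewrite -[X in _ --> X](subr0 0); apply: cvgB => /=.
    have := Fcvg 1 (normr1 _); by under eq_fun do rewrite mul1r.
  have := Fcvg (-1); rewrite normrN1 => /(_ erefl); by under eq_fun do rewrite mulN1r.
suff H : (\int[leb]_(x in I n) (f x)%:E)%E @[n --> \oo] --> (\int[leb]_x (f x)%:E)%E.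
  by rewrite /Rintegral (cvg_unique _ H Icvg).
under eq_fun do rewrite integral_mkcond.
have [] // := @dominated_convergence _ _ _ leb setT measurableT
  (fun n => ((EFin \o f) \_ (I n))) (EFin \o f) (abse \o (EFin \o f)).
- move=> n; have mfI : measurable_fun (I n) (EFin \o f) by apply/measurable_EFinP;
    exact: (measurable_funS measurableT (@subsetT _ _) mf).
  exact: ((measurable_restrictT _ (mI n)).1 mfI).
- by apply/measurable_EFinP; exact: mf.
- apply: aeW => x _; apply: cvg_near_cst.
  near=> n; rewrite patchE mem_set// /I/= in_itv/= -ler_norml.
  apply: (@le_trans _ _ n%:R); last by rewrite ler_nat.
  near: n; exact: nbhs_infty_ger.
- exact: integrable_abse.
- apply: aeW => x n _; rewrite patchE; case: ifP => // _.
  by rewrite abse0 abse_ge0.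
Unshelve. all: by end_near. Qed.

End Gaussian.

(** * The Fourier transform of a Gaussian with quadratic phase *)

Section OscillatoryGaussian.
Variable R : realType.
Notation leb := (@lebesgue_measure R).
Variables (a t : R).
Hypothesis a0 : 0 < a.
Implicit Types (y e x : R).

Let phi e y x := y * x + t * x ^+ 2 + e.

(** The free phase [e] keeps the computation real: [e = 0] gives the real part, [e = - pi / 2] the
    imaginary part, and differentiating the cosine shifts [e] by pi / 2, so the family is closed
    under d/dx and d/dy up to polynomial factors. *)
Definition osc e y x := gauss a 0 x * cos (phi e y x).

Let dphi e y x : is_derive x 1 (phi e y) (y + 2 * t * x).
Proof. by apply: is_derive_eq; rewrite /GRing.scale/=; ring. Qed.

Let dosc e y x : is_derive x 1 (osc e y)
  (- 2 * a * (x * osc e y x) + y * osc (e + pi / 2) y x + 2 * t * (x * osc (e + pi / 2) y x)).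
Proof.
have dg := is_derive_gauss a 0 x.
have dp := dphi e y x.
apply: is_derive_eq.
rewrite /osc /phi /GRing.scale/= [in RHS]addrA !cosDpihalf !subr0; ring.
Qed.

Let dxosc e y x : is_derive x 1 (fun x => x * osc e y x)
  (osc e y x + x * (- 2 * a * (x * osc e y x) + y * osc (e + pi / 2) y x + 2 * t * (x * osc
      (e + pi / 2) y x))).
Proof.
have dg := dosc e y x.
apply: is_derive_eq.
by rewrite /GRing.scale/=; ring.
Qed.

Let dosc_y e y x : is_derive y 1 (osc e ^~ x) (x * osc (e + pi / 2) y x).
Proof.
have dp : is_derive y 1 (phi e ^~ x) x.
  by apply: is_derive_eq; rewrite /GRing.scale/=; ring.
apply: is_derive_eq.
by rewrite /osc /phi /GRing.scale/= [in RHS]addrA !cosDpihalf; ring.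
Qed.

Let cosc e y : continuous (osc e y).
Proof. by move=> x; apply: (continuous_is_derive (dosc e y)). Qed.

Let cxosc e y : continuous (fun x => x * osc e y x).
Proof. by move=> x; apply: (continuous_is_derive (dxosc e y)). Qed.

Lemma gdom_osc e y : gdominated (osc e y).
Proof.
split; first by apply: continuous_measurable_fun; exact: cosc.
exists 1, a; split => // x; rewrite mul1r normrM ger0_norm ?gauss_ge0//.
by rewrite ler_piMr ?gauss_ge0// cos_max.
Qed.

Let xosc_bound e y x : `|x * osc e y x| <= (1 + (a / 2)^-1) * gauss (a / 2) 0 x.
Proof.
rewrite normrM normrM (ger0_norm (gauss_ge0 _ _ _)) mulrA.
rewrite (@le_trans _ _ (`|x| * gauss a 0 x))//.
  by rewrite ler_piMr ?cos_max// mulr_ge0// gauss_ge0.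
have := @sqr_gauss_le _ (a / 2) 0 x; rewrite subr0 mulrCA divff// mulr1.
rewrite divr_gt0// => /(_ isT) H.
rewrite mulrDl mul1r.
have H2 : gauss a 0 x <= gauss (a / 2) 0 x.
  by rewrite ler_expR ler_wpM2r ?sqr_ge0// lerN2 ler_pdivrMr// ler_peMr ?ler1n// ltW.
have H3 : `|x| <= 1 + x ^+ 2.
  rewrite -real_normK ?num_real//; have := sqr_ge0 (`|x| - 1); nra.
apply: (@le_trans _ _ ((1 + x ^+ 2) * gauss a 0 x)).
  by rewrite ler_wpM2r ?gauss_ge0.
by rewrite mulrDl mul1r lerD.
Qed.

Lemma gdom_xosc e y : gdominated (fun x => x * osc e y x).
Proof.
split; first by apply: continuous_measurable_fun; exact: cxosc.
exists (1 + (a / 2)^-1), (a / 2); split => //.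
- by rewrite addr_ge0// invr_ge0 divr_ge0// ltW.
- exact: divr_gt0.
Qed.

Definition oscI e y := \int[leb]_x osc e y x.
Let xoscI e y := \int[leb]_x (x * osc e y x).

Let oscI_parts e y :
  - 2 * a * xoscI e y + y * oscI (e + pi / 2) y + 2 * t * xoscI (e + pi / 2) y = 0.
Proof.
have i1 := gdominated_integrable (gdom_xosc e y).
have i2 := gdominated_integrable (gdom_osc (e + pi / 2) y).
have i3 := gdominated_integrable (gdom_xosc (e + pi / 2) y).
have i1' := integrableZl measurableT (- 2 * a) i1.
have i2' := integrableZl measurableT y i2.
have i3' := integrableZl measurableT (2 * t) i3.
rewrite /oscI /xoscI -!RintegralZl//.
rewrite -RintegralD// -RintegralD//; last exact: (integrableD measurableT i1' i2').
apply: (@integral_derive_eq0 _ (osc e y)).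
- exact: dosc.
- move=> x; apply: cvgD; first apply: cvgD.
  + by apply: cvgM; [exact: cvg_cst|exact: cxosc].
  + by apply: cvgM; [exact: cvg_cst|exact: cosc].
  + by apply: cvgM; [exact: cvg_cst|exact: cxosc].
- apply: gdominatedD; first apply: gdominatedD.
  + exact/gdominatedZ/gdom_xosc.
  + exact/gdominatedZ/gdom_osc.
  + exact/gdominatedZ/gdom_xosc.
- exact: gdom_osc.
Qed.

Let d_oscI e y : is_derive y 1 (oscI e) (xoscI (e + pi / 2) y).
Proof.
have Iy : `](y - 1), (y + 1)[%classic y by rewrite /= in_itv/=; apply/andP; split; lra.
have intf (x : R) : `](y - 1), (y + 1)[%classic x -> leb.-integrable setT (EFin \o osc e x).
  by move=> _; exact/gdominated_integrable/gdom_osc.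
have der (x z : R) : `](y - 1), (y + 1)[%classic x -> setT z -> derivable (osc e ^~ z) x 1.
  by move=> _ _; exact: (@ex_derive _ _ _ _ _ _ _ (dosc_y e x z)).
have d1 x z : partial1of2 (osc e) x z = z * osc (e + pi / 2) x z.
  by rewrite partial1of2E; exact: (@derive_val _ _ _ _ _ _ _ (dosc_y e x z)).
pose G x := (1 + (a / 2)^-1) * gauss (a / 2) 0 x.
have G0 x : 0 <= G x.
  by rewrite mulr_ge0 ?gauss_ge0// addr_ge0// invr_ge0 divr_ge0// ltW.
have iG : leb.-integrable setT (EFin \o G).
  by have := integrableZl measurableT (1 + (a / 2)^-1) (integrable_gauss 0 (divr_gt0 a0
      (ltr0Sn R 1))).
have Gub (x z : R) : `](y - 1), (y + 1)[%classic x -> setT z ->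
    `|partial1of2 (osc e) x z| <= G z.
  by move=> _ _; rewrite d1; exact: xosc_bound.
apply: DeriveDef.
  exact: (derivable_under_integral measurableT Iy intf der G0 iG Gub).
rewrite -derive1E (differentiation_under_integral measurableT Iy intf der G0 iG Gub).
by apply: eq_Rintegral => z _; rewrite d1.
Qed.

(** [al + i be] is 1 / (4 (a - i t)): up to a constant, exp(- (a - i t) x^2) has the transform exp(-
    y^2 / (4 (a - i t))). *)
Let al := a / (4 * (a ^+ 2 + t ^+ 2)).
Let be := t / (4 * (a ^+ 2 + t ^+ 2)).

Let addpih z : z + pi / 2 + pi / 2 = z + pi :> R.
Proof. by rewrite -addrA -splitr. Qed.

Let oscIpi e y : oscI (e + pi) y = - oscI e y.
Proof.
rewrite -[RHS]mulN1r /oscI -RintegralZl//; last exact/gdominated_integrable/gdom_osc.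
by apply: eq_Rintegral => x _; rewrite /osc /phi addrA cosDpi mulrN mulN1r.
Qed.

Let xoscIpi e y : xoscI (e + pi) y = - xoscI e y.
Proof.
rewrite -[RHS]mulN1r /xoscI -RintegralZl//; last exact/gdominated_integrable/gdom_xosc.
by apply: eq_Rintegral => x _; rewrite /osc /phi addrA cosDpi !mulrN mulN1r.
Qed.

(** Integration by parts at the phases [e] and [e + pi / 2] gives a 2 x 2 linear system for the two
    first moments, because a shift by pi only changes the sign; eliminating one moment leaves the
    factor 2 (a^2 + t^2) on the other. The outcome turns [d_oscI] into a closed linear ODE in
    [y]. *)
Let xoscIE e y : xoscI (e + pi / 2) y = - 2 * y * (al * oscI e y + be * oscI (e + pi / 2) y).
Proof.
have h1 := oscI_parts e y; have h2 := oscI_parts (e + pi / 2) y.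
rewrite addpih oscIpi xoscIpi in h2.
have p0 : a ^+ 2 + t ^+ 2 != 0.
  by rewrite gt_eqF// ltr_pwDl ?exprn_gt0// sqr_ge0.
apply: (mulfI (_ : 2 * (a ^+ 2 + t ^+ 2) != 0)); first by rewrite mulf_neq0.
rewrite /al /be.
transitivity (- y * (a * oscI e y + t * oscI (e + pi / 2) y)); last by field.
apply/eqP; rewrite -subr_eq0; apply/eqP.
have := congr2 (fun u v => t * u - a * v) h1 h2.
rewrite !mulr0 subrr => H.
by rewrite -[RHS]H; ring.
Qed.

(** [E] below is a first integral of this ODE: it undoes the decay exp(- al y^2) and the rotation by
    be y^2, and it equals [oscI e 0] at y = 0. Its values at [e] and [e + pi / 2] are then
    recombined by the inverse rotation. *)
Lemma oscIE e y : oscI e y = expR (- al * y ^+ 2) *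
  (cos (be * y ^+ 2) * oscI e 0 - sin (be * y ^+ 2) * oscI (e + pi / 2) 0).
Proof.
pose E e y := expR (al * y ^+ 2) *
  (cos (be * y ^+ 2) * oscI e y + sin (be * y ^+ 2) * oscI (e + pi / 2) y).
have dE e' y' : is_derive y' 1 (E e') 0.
  have d1 := d_oscI e' y'; have d2 := d_oscI (e' + pi / 2) y'.
  apply: is_derive_eq; rewrite !xoscIE addpih oscIpi /GRing.scale/=; ring.
have EE e' y' : expR (al * y' ^+ 2) *
    (cos (be * y' ^+ 2) * oscI e' y' + sin (be * y' ^+ 2) * oscI (e' + pi / 2) y') = oscI e' 0.
  have := is_derive_0_is_cst y' 0 (dE e'); rewrite /E => ->.
  by rewrite expr0n/= !mulr0 expR0 cos0 sin0 !mul1r mul0r addr0.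
rewrite -{1}(EE e y) -(EE (e + pi / 2) y) addpih oscIpi mulNr expRN.
set s := sin _; set c := cos _; set X := expR _.
have X0 : X != 0 by rewrite gt_eqF// expR_gt0.
have cs : c ^+ 2 + s ^+ 2 = 1 by exact: cos2Dsin2.
rewrite (_ : c * _ - _ = X * oscI e y * (c ^+ 2 + s ^+ 2)); last by ring.
by rewrite cs mulr1 mulKf.
Qed.

End OscillatoryGaussian.

(** * Elementary bounds for cosines and complex moduli *)

Section Trigonometry.
Variable R : realType.
Implicit Types x : R.

Lemma sin_le_id x : 0 <= x -> sin x <= x.
Proof.
move=> x0.
have [c _] := @MVT_segment _ sin cos 0 x x0 (fun z _ => is_derive_sin z)
  (continuous_subspaceT (@continuous_sin R)).
by rewrite sin0 !subr0 => ->; rewrite ler_piMl// cos_le1.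
Qed.

Lemma cos_ge_onem x : 1 - `|x| <= cos x.
Proof.
have -> : cos x = cos `|x| by case: (ger0P x) => //; rewrite cosN.
have := normr_ge0 x; move: `|x| => {}x x0.
have [c _] := @MVT_segment _ cos (fun z => - sin z) 0 x x0 (fun z _ => is_derive_cos z)
  (continuous_subspaceT (@continuous_cos R)).
rewrite cos0 subr0 => e; rewrite -(subrK 1 (cos x)) e addrC lerD2r mulNr lerN2.
by rewrite ler_piMl// sin_le1.
Qed.

Lemma cos_ge_onem_sqr x : 1 - x ^+ 2 <= cos x.
Proof.
rewrite -(real_normK (num_real x)).
have -> : cos x = cos `|x| by case: (ger0P x) => //; rewrite cosN.
have := normr_ge0 x; move: `|x| => {}x x0.
have [c] := @MVT_segment _ cos (fun z => - sin z) 0 x x0 (fun z _ => is_derive_cos z)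
  (continuous_subspaceT (@continuous_cos R)).
rewrite in_itv/= => /andP[c0 cx].
rewrite cos0 subr0 => e; rewrite -(subrK 1 (cos x)) e addrC lerD2r mulNr lerN2 expr2.
by rewrite ler_wpM2r// (le_trans (sin_le_id c0)).
Qed.

Lemma cosDnat2pi x k : cos (x + 2 * pi * k%:R) = cos x.
Proof.
elim: k => [|k IH]; first by rewrite mulr0 addr0.
by rewrite -[k.+1%:R]natr1 mulrDr mulr1 addrA mulr_natl cosD2pi -mulr_natl.
Qed.

Lemma cosDint2pi x (k : int) : cos (x + 2 * pi * k%:~R) = cos x.
Proof.
case: k => n; first exact: cosDnat2pi.
rewrite NegzE -[LHS](cosDnat2pi _ n.+1).
by congr cos; rewrite mulrNz mulrN subrK.
Qed.

Lemma expiD x y : expi (x + y) = expi x * expi y.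
Proof. by rewrite /expi cosD sinD [X in _ +i* X]addrC. Qed.

Lemma expi0 : expi 0 = 1 :> R[i].
Proof. by rewrite /expi cos0 sin0. Qed.

Lemma normc_ge0 (z : R[i]) : 0 <= normc z.
Proof. by case: z => a b; exact: sqrtr_ge0. Qed.

Lemma normc_expi x : normc (expi x) = 1.
Proof. by rewrite /expi/= cos2Dsin2 sqrtr1. Qed.

Lemma normc_real x : normc x%:C = `|x|.
Proof. by rewrite /= expr0n addr0 sqrtr_sqr. Qed.

Lemma Re_le_normc (z : R[i]) : `|Re z| <= normc z.
Proof. by case: z => a b /=; rewrite -sqrtr_sqr ler_wsqrtr// lerDl sqr_ge0. Qed.

Lemma Im_le_normc (z : R[i]) : `|Im z| <= normc z.
Proof. by case: z => a b /=; rewrite -sqrtr_sqr ler_wsqrtr// lerDr sqr_ge0. Qed.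

End Trigonometry.

(** * Complex functions with Gaussian decay *)

Section DominatedComplex.
Variable R : realType.
Notation leb := (@lebesgue_measure R).
Implicit Types (f g : measurableTypeR R -> R[i]).

Definition cgdominated f :=
  cmeasurable f /\
  exists C c, [/\ 0 <= C, 0 < c & forall x, normc (f x) <= C * gauss c 0 x].

Lemma cgdominated_integrableC f : cgdominated f -> integrableC leb f.
Proof.
move=> [[mr mi] [C [c [C0 c0 fC]]]]; split; apply: gdominated_integrable;
  (split; [by []|exists C, c; split=> // x]).
  exact: le_trans (Re_le_normc _) (fC x).
exact: le_trans (Im_le_normc _) (fC x).
Qed.

Lemma cmeasurable_normc d (T : measurableType d) (f : T -> R[i]) :
  cmeasurable f -> measurable_fun setT (fun x => normc (f x)).
Proof.
move=> [mr mi].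
rewrite (_ : (fun _ => _) = (fun x => Num.sqrt (Re (f x) ^+ 2 + Im (f x) ^+ 2))).
  apply: (measurableT_comp (f := @Num.sqrt R)); first by apply: continuous_measurable_fun;
      exact: sqrt_continuous.
  by apply: measurable_funD; apply: measurable_funX.
by apply/funext => x; case: (f x).
Qed.

Lemma gdominated_normc f : cgdominated f -> gdominated (fun x => normc (f x)).
Proof.
move=> [mf [C [c [C0 c0 fC]]]]; split; first exact: cmeasurable_normc.
by exists C, c; split => // x; rewrite ger0_norm ?normc_ge0.
Qed.

Lemma gauss_le1 (c w x : R) : 0 < c -> gauss c w x <= 1.
Proof.
by move=> c0; rewrite -expR0 ler_expR mulNr oppr_le0 mulr_ge0 ?sqr_ge0// ltW.
Qed.

Lemma gdominatedM (f g : R -> R) : gdominated f -> gdominated g ->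
  gdominated (fun x => f x * g x).
Proof.
move=> [mf [C [c [C0 c0 fC]]]] [mg [D [d [D0 d0 gD]]]].
split; first exact: measurable_funM.
exists (C * D), c; split; rewrite ?mulr_ge0// => x.
rewrite normrM mulrAC ler_pM//.
by rewrite (le_trans (gD x))// ler_piMr// gauss_le1.
Qed.

Lemma cmeasurableD d (T : measurableType d) (f g : T -> R[i]) :
  cmeasurable f -> cmeasurable g -> cmeasurable (fun x => f x + g x).
Proof.
move=> [fr fi] [gr gi]; split.
  rewrite (_ : (fun _ => _) = (fun x => Re (f x) + Re (g x))).
    exact: measurable_funD.
  by apply/funext => x; case: (f x) (g x) => a b [].
rewrite (_ : (fun _ => _) = (fun x => Im (f x) + Im (g x))).
  exact: measurable_funD.
by apply/funext => x; case: (f x) (g x) => a b [].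
Qed.

Lemma cgdominatedD f g : cgdominated f -> cgdominated g ->
  cgdominated (fun x => f x + g x).
Proof.
move=> df dg; split; first exact: cmeasurableD df.1 dg.1.
have [_ [C [c [C0 c0 H]]]] := gdominatedD (gdominated_normc df) (gdominated_normc dg).
exists C, c; split => // x; apply: le_trans (H x).
by rewrite ger0_norm ?addr_ge0 ?normc_ge0//; exact: le_normcD.
Qed.

Lemma cgdominated0 : cgdominated (fun=> 0).
Proof. by split => //; exists 0, 1; split => // x; rewrite Normc.normc0 mul0r. Qed.

Lemma cgdominated_sum n (F : 'I_n -> R -> R[i]) :
  (forall i, cgdominated (F i)) -> cgdominated (fun x => \sum_(i < n) F i x).
Proof.
elim: n F => [|n IH] F dF.
  rewrite (_ : (fun _ => _) = (fun=> 0)); first exact: cgdominated0.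
  by apply/funext => x; rewrite big_ord0.
under eq_fun do rewrite big_ord_recl.
by apply: cgdominatedD => //; exact: IH.
Qed.

Lemma cgdominatedZ z f : cgdominated f -> cgdominated (fun x => z * f x).
Proof.
move=> df; split; first by apply: cmeasurableM df.1; split; exact: measurable_cst.
have [_ [C [c [C0 c0 H]]]] := gdominatedZ (normc z) (gdominated_normc df).
exists C, c; split => // x; apply: le_trans (H x).
by rewrite Normc.normcM ger0_norm ?mulr_ge0 ?normc_ge0.
Qed.

Lemma cmeasurable_expi d (T : measurableType d) (p : T -> R) :
  measurable_fun setT p -> cmeasurable (fun x => expi (p x)).
Proof.
move=> mp; split.
  by apply: (measurableT_comp (f := cos)) => //; apply: continuous_measurable_fun;
      exact: continuous_cos.
by apply: (measurableT_comp (f := sin)) => //; apply: continuous_measurable_fun;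
    exact: continuous_sin.
Qed.

Lemma cgdominated_expi (p : R -> R) f : measurable_fun setT p ->
  cgdominated f -> cgdominated (fun x => expi (p x) * f x).
Proof.
move=> mp df; split; first exact: (cmeasurableM (cmeasurable_expi mp) df.1).
have [_ [C [c [C0 c0 H]]]] := df; exists C, c; split => // x.
by rewrite Normc.normcM normc_expi mul1r.
Qed.

Lemma cgdominated_real (g : R -> R) : gdominated g -> cgdominated (fun x => (g x)%:C).
Proof.
move=> [mg [C [c [C0 c0 H]]]]; split; first by split => //=; exact: measurable_cst.
by exists C, c; split => // x; rewrite normc_real.
Qed.

End DominatedComplex.

(** * Schrödinger evolution of Gaussian wave packets *)

Section Translation.
Variable R : realType.
Notation leb := (@lebesgue_measure R).

Lemma ge0_integral_shift (f : R -> R) w : continuous f -> (forall x, 0 <= f x) ->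
  (\int[leb]_x (f x)%:E = \int[leb]_x (f (x + w))%:E)%E.
Proof.
move=> cf f0.
have dF (x : R) : is_derive x 1 (fun x : R => x + w) (1 : R).
  by apply: is_derive_eq; rewrite addr0.
have F' : (fun x : R => x + w)^`()%classic = cst 1.
  by apply/funext => x; rewrite derive1E (@derive_val _ _ _ _ _ _ _ (dF x)).
rewrite (@increasing_ge0_integration_by_substitutionT R (fun x => x + w) f)//.
- by apply: eq_integral => x _; rewrite F' /= mulr1.
- by move=> x y xy; rewrite ltrD2r.
- by rewrite F'; exact: cst_continuous.
- by rewrite F'; exact: is_cvg_cst.
- by rewrite F'; exact: is_cvg_cst.
- apply/cvgrNyPle => A; near=> x; rewrite -lerBrDr; near: x; apply: nbhs_ninfty_le;
    exact: num_real.
- apply/cvgryPge => A; near=> x; rewrite -lerBlDr; near: x; apply: nbhs_pinfty_ge;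
    exact: num_real.
Unshelve. all: by end_near. Qed.

Lemma gdominated_shift (f : R -> R) w : gdominated f -> gdominated (fun x => f (x + w)).
Proof.
move=> [mf [C [c [C0 c0 fC]]]]; split.
  by apply: (measurableT_comp mf); apply: measurable_funD.
have [_ [D [d [D0 d0 gD]]]] := gdominated_gauss (- w) c0.
exists (C * D), d; split => //; first exact: mulr_ge0.
move=> x; rewrite (le_trans (fC _))// -mulrA ler_wpM2l//.
by have := gD x; rewrite ger0_norm ?gauss_ge0// /gauss opprK !subr0.
Qed.

(** Nonnegative functions are shifted by change of variables; a signed [f] is reduced to them by
    adding the Gaussian [g] that dominates it and cancelling the integral of [g]. *)
Lemma Rintegral_shift (f : R -> R) w : continuous f -> gdominated f ->
  \int[leb]_x f (x + w) = \int[leb]_x f x.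
Proof.
move=> cf df; have [_ [C [c [C0 c0 fC]]]] := df.
pose g x := C * gauss c 0 x.
have cg : continuous g.
  by move=> x; apply: cvgM; [exact: cvg_cst|exact: continuous_gauss].
have g0 x : 0 <= g x by rewrite mulr_ge0 ?gauss_ge0.
have dg : gdominated g by apply/gdominatedZ/gdominated_gauss.
have ig := gdominated_integrable dg.
have ifs := gdominated_integrable (gdominated_shift w df).
have igs := gdominated_integrable (gdominated_shift w dg).
have if_ := gdominated_integrable df.
apply: (addIr (\int[leb]_x g x)).
rewrite -[in RHS]RintegralD//.
have <- : \int[leb]_x g (x + w) = \int[leb]_x g x.
  by rewrite /Rintegral (ge0_integral_shift w cg g0).
have ch : continuous (fun x => f x + g x).
  by move=> x; apply: cvgD; [exact: cf|exact: cg].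
have h0 x : 0 <= f x + g x.
  by rewrite -lerBlDr sub0r lerNl (le_trans _ (fC x))// -normrN ler_norm.
rewrite -(RintegralD measurableT ifs igs) /Rintegral; congr fine.
exact: esym (ge0_integral_shift w ch h0).
Qed.

End Translation.

Section GaussianWave.
Variable R : realType.
Notation leb := (@lebesgue_measure R).
Implicit Types a t w x y : R.

(** The evolution at time [t] and position [y] of a one-dimensional datum whose transform is a
    Gaussian centred at 0. *)
Definition gwave a t y : R[i] :=
  intC leb (fun x => expi (y * x + t * x ^+ 2) * (gauss a 0 x)%:C).

Let reE u v : Re (expi u * v%:C : R[i]) = v * cos (u + 0).
Proof. by rewrite /= mulr0 subr0 addr0 mulrC. Qed.

Let imE u v : Im (expi u * v%:C : R[i]) = v * cos (u - pi / 2).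
Proof. by rewrite /= cosBpihalf mulr0 add0r mulrC. Qed.

Let gwave_osc a t y : gwave a t y = oscI a t 0 y +i* oscI a t (- (pi / 2)) y.
Proof.
rewrite /gwave /intC /oscI /osc; congr (_ +i* _); apply: eq_Rintegral => x _.
  by rewrite reE.
by rewrite imE.
Qed.

(** The factor [gwave a t 0], a complex square root of pi / (a - i t), is left unevaluated: it is
    common to all Gaussians of one packet, and a lower bound for its modulus suffices for the
    evolution. *)
Lemma gwaveE a t y : 0 < a ->
  gwave a t y = (expR (- (a / (4 * (a ^+ 2 + t ^+ 2))) * y ^+ 2))%:C *
    expi (- (t / (4 * (a ^+ 2 + t ^+ 2))) * y ^+ 2) * gwave a t 0.
Proof.
move=> a0; rewrite !gwave_osc (oscIE t a0 0 y) (oscIE t a0 (- (pi / 2)) y).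
rewrite addNr add0r.
have -> : oscI a t (pi / 2) 0 = - oscI a t (- (pi / 2)) 0.
  rewrite -[RHS]mulN1r /oscI -RintegralZl//; last exact/gdominated_integrable/gdom_osc.
  apply: eq_Rintegral => x _; rewrite /osc mul0r add0r cosBpihalf cosDpihalf; ring.
rewrite /expi !mulNr cosN sinN.
by apply/eqP; rewrite eq_complex/=; apply/andP; split; apply/eqP; ring.
Qed.

Let continuous_wave a w t y e : continuous (fun x =>
    gauss a w x * cos (y * x + t * x ^+ 2 + e)).
Proof.
pose df x := - 2 * a * (x - w) * gauss a w x * cos (y * x + t * x ^+ 2 + e) -
  gauss a w x * (y + 2 * t * x) * sin (y * x + t * x ^+ 2 + e).
have d (x : R) : is_derive x 1 (fun x : R => gauss a w x * cos (y * x + t * x ^+ 2 + e)) (df x).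
  by have dg := is_derive_gauss a w x; apply: is_derive_eq; rewrite /df /GRing.scale/=; ring.
by move=> x; apply: (continuous_is_derive d).
Qed.

Let gdominated_wave a w t y e : 0 < a ->
  gdominated (fun x => gauss a w x * cos (y * x + t * x ^+ 2 + e)).
Proof.
move=> a0; apply: (@gdominated_le _ _ (gauss a w)); last 2 first.
- exact: gdominated_gauss.
- move=> x; rewrite normrM ler_piMr// cos_max//.
by apply: continuous_measurable_fun; exact: continuous_wave.
Qed.

(* Completing the square: the substitution [x -> x + w] is a Galilean boost. *)
Lemma intC_wave_packet a t w y : 0 < a ->
  intC leb (fun x => expi (y * x + t * x ^+ 2) * (gauss a w x)%:C) =
  expi (y * w + t * w ^+ 2) * gwave a t (y + 2 * t * w).
Proof.
move=> a0; rewrite /gwave -intCZ; last first.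
  apply: cgdominated_integrableC; apply: cgdominated_expi.
    by apply: measurable_funD; apply: measurable_funM.
  exact/cgdominated_real/gdominated_gauss.
have E x : expi (y * w + t * w ^+ 2) * (expi ((y + 2 * t * w) * x + t * x ^+ 2) *
    (gauss a 0 x)%:C) =
    expi (y * (x + w) + t * (x + w) ^+ 2) * (gauss a w (x + w))%:C.
  rewrite mulrA -expiD /gauss addrK subr0; congr (expi _ * _); ring.
under [in RHS]eq_fun do rewrite E.
rewrite /intC; pose F x : R[i] := expi (y * x + t * x ^+ 2) * (gauss a w x)%:C.
have hr : \int[leb]_x Re (F (x + w)) = \int[leb]_x Re (F x).
  under eq_Rintegral do rewrite reE.
  under [RHS]eq_Rintegral do rewrite reE.
  exact: Rintegral_shift (@continuous_wave a w t y _) (gdominated_wave w t y _ a0).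
have hi : \int[leb]_x Im (F (x + w)) = \int[leb]_x Im (F x).
  under eq_Rintegral do rewrite imE.
  under [RHS]eq_Rintegral do rewrite imE.
  exact: Rintegral_shift (@continuous_wave a w t y _) (gdominated_wave w t y _ a0).
by rewrite hr hi.
Qed.

Lemma gwave0E a y : 0 < a ->
  gwave a 0 y = (Num.sqrt (pi / a) * gauss (4 * a)^-1 0 y)%:C.
Proof.
move=> a0; rewrite gwaveE// mul0r oppr0 mul0r expi0 mulr1.
have -> : gwave a 0 0 = (Num.sqrt (pi / a))%:C.
  rewrite gwave_osc; congr (_ +i* _).
    rewrite -(integral_gauss 0 a0) /oscI; apply: eq_Rintegral => x _.
    by rewrite /osc !mul0r !addr0 cos0 mulr1.
  rewrite /oscI; under eq_Rintegral do rewrite /osc !mul0r addr0 cosBpihalf sin0 mulr0.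
  by rewrite Rintegral_cst// mul0r.
rewrite -rmorphM/= mulrC; congr (_ * expR _)%:C.
by rewrite subr0 expr0n addr0; field; rewrite gt_eqF.
Qed.

(** Up to time [a / 8] the Gaussian has barely dispersed. By cos u >= 1 - u the loss is at most t
    x^2 under the Gaussian; absorbing x^2 at the rate [a / 2] costs at most (2 t / a) sqrt 2 <= 3/8
    of the mass, which leaves more than a half. *)
Lemma normc_gwave0_ge a t : 0 < a -> 0 <= t -> t <= a / 8 ->
  Num.sqrt (pi / a) / 2 <= normc (gwave a t 0).
Proof.
move=> a0 t0 ta; apply: le_trans (Re_le_normc _).
apply: le_trans (ler_norm _); rewrite gwave_osc/= /oscI.
have i1 := integrable_gauss 0 a0.
have a20 : 0 < a / 2 by rewrite divr_gt0.
have i2 := integrable_gauss 0 a20.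
have i2' := integrableZl measurableT (t * (2 / a)) i2.
apply: (@le_trans _ _ (\int[leb]_x (gauss a 0 x - t * (2 / a) * gauss (a / 2) 0 x))).
  rewrite RintegralB// RintegralZl// !integral_gauss//.
  have -> : pi / (a / 2) = 2 * (pi / a) by field; rewrite gt_eqF.
  rewrite [Num.sqrt (2 * _)]sqrtrM// mulrA -[X in X - _]mul1r -mulrBl mulrC ler_wpM2r
      ?sqrtr_ge0//.
  have s2 : Num.sqrt 2 <= 3 / 2 :> R.
    rewrite -(@ler_pXn2r _ 2)// ?nnegrE ?sqrtr_ge0// sqr_sqrtr//; lra.
  have tq : t * (2 / a) <= 1 / 4 by rewrite mulrA ler_pdivrMr//; lra.
  have := ler_pM _ _ tq s2;
      rewrite !sqrtr_ge0 mulr_ge0 ?divr_ge0 ?(ltW a0)// => /(_ isT isT); lra.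
apply: le_Rintegral => //.
- by have := integrableB measurableT i1 i2'.
- exact/gdominated_integrable/gdom_osc.
move=> x _; rewrite /osc mul0r add0r addr0.
have H := sqr_gauss_le 0 x a20; rewrite mulrCA divff// mulr1 in H.
apply: (@le_trans _ _ (gauss a 0 x * (1 - t * x ^+ 2))).
  rewrite mulrBr mulr1 lerD2l lerN2 mulrCA -mulrA ler_wpM2l//.
  by rewrite mulrC -[x ^+ 2](congr1 (fun z => z ^+ 2) (subr0 x)) -[2 / a]invf_div.
apply: ler_wpM2l; first exact: gauss_ge0.
by have := cos_ge_onem (t * x ^+ 2); rewrite ger0_norm// mulr_ge0// sqr_ge0.
Qed.

End GaussianWave.

Lemma Rintegral_gdominated_sum (R : realType) n (F : 'I_n -> R -> R) :
  (forall i, gdominated (F i)) ->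
  \int[@lebesgue_measure R]_x (\sum_(i < n) F i x) =
  \sum_(i < n) \int[@lebesgue_measure R]_x F i x.
Proof.
elim: n F => [|n IH] F dF.
  under eq_Rintegral do rewrite big_ord0.
  by rewrite big_ord0 Rintegral_cst// mul0r.
under eq_Rintegral do rewrite big_ord_recl.
rewrite RintegralD// ?big_ord_recl ?IH//; first exact: gdominated_integrable.
exact/gdominated_integrable/gdominated_sum.
Qed.

(** * Sums of equally spaced Gaussians in one frequency variable *)

Section Packet.
Variable R : realType.
Notation leb := (@lebesgue_measure R).
Variables (a th L : R) (K : nat).
Hypothesis a0 : 0 < a.
Implicit Types (t x y : R).

Let w (m : 'I_K) : R := th + L * m%:R.

Definition packet x : R := \sum_(m < K) gauss a (w m) x.

(** The inverse Fourier transform of [packet] in closed form: [packet] lives on the frequency side,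
    and this is the datum itself. Its Gaussian decay puts it in L^1 and L^2, where the transform is
    an ordinary integral. *)
Definition packet_source x : R[i] :=
  \sum_(m < K) (Num.sqrt (pi / a))%:C * (expi (w m * x) * (gauss (4 * a)^-1 0 x)%:C).

Definition packet_evol t y : R[i] :=
  \sum_(m < K) expi (y * w m + t * w m ^+ 2) * gwave a t (y + 2 * t * w m).

Let a40 : 0 < (4 * a)^-1. Proof. by rewrite invr_gt0 mulr_gt0. Qed.

Let measurable_phase y t : measurable_fun setT (fun x => y * x + t * x ^+ 2).
Proof. by apply: measurable_funD; apply: measurable_funM. Qed.

Lemma gdominated_packet : gdominated packet.
Proof. by apply: gdominated_sum => m; exact: gdominated_gauss. Qed.

Lemma cgdominated_source : cgdominated packet_source.
Proof.
apply: cgdominated_sum => m; apply: cgdominatedZ; apply: cgdominated_expi.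
  exact: measurable_funM.
exact/cgdominated_real/gdominated_gauss.
Qed.

Lemma cgdominated_evol t : cgdominated (packet_evol t).
Proof.
apply: cgdominated_sum => m; apply: cgdominated_expi.
  by apply: measurable_funD => //; apply: measurable_funM.
under eq_fun do rewrite gwaveE// mulrC (mulrC _%:C).
apply: cgdominatedZ; apply: cgdominated_expi.
  by apply: measurable_funM => //; apply: measurable_funX; exact: measurable_funD.
apply: cgdominated_real.
have al0 : 0 < a / (4 * (a ^+ 2 + t ^+ 2)).
  by rewrite divr_gt0// mulr_gt0// ltr_pwDl ?exprn_gt0// sqr_ge0.
rewrite (_ : (fun _ => _) = gauss (a / (4 * (a ^+ 2 + t ^+ 2))) (- (2 * t * w m))).
  exact: gdominated_gauss.
by apply/funext => x; rewrite /gauss opprK.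
Qed.

Lemma intC_packet t y :
  intC leb (fun x => expi (y * x + t * x ^+ 2) * (packet x)%:C) = packet_evol t y.
Proof.
rewrite /packet_evol; under [RHS]eq_bigr do rewrite -intC_wave_packet//.
rewrite -intC_sum.
  by congr intC; apply/funext => x; rewrite /packet raddf_sum/= mulr_sumr.
move=> m; apply: cgdominated_integrableC; apply: cgdominated_expi => //.
exact/cgdominated_real/gdominated_gauss.
Qed.

Lemma intC_source x :
  intC leb (fun y => expi (- (y * x)) * packet_source y) = (2 * pi * packet x)%:C.
Proof.
have E y : expi (- (y * x)) * packet_source y = \sum_(m < K)
    (Num.sqrt (pi / a))%:C * (expi ((w m - x) * y + 0 * y ^+ 2) * (gauss (4 * a)^-1 0 y)%:C).
  rewrite /packet_source mulr_sumr; apply: eq_bigr => m _.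
  rewrite mulrCA; congr (_ * _); rewrite mulrA -expiD; congr (expi _ * _); ring.
under eq_fun do rewrite E.
have iw m : integrableC leb (fun y =>
    expi ((w m - x) * y + 0 * y ^+ 2) * (gauss (4 * a)^-1 0 y)%:C).
  apply: cgdominated_integrableC; apply: cgdominated_expi => //.
  exact/cgdominated_real/gdominated_gauss.
rewrite intC_sum; last by move=> m; exact: integrableCZ.
rewrite /packet mulr_sumr raddf_sum/=; apply: eq_bigr => m _.
rewrite intCZ// intC_wave_packet// !(mulr0, mul0r, addr0) expi0 mul1r.
rewrite gwave0E// -rmorphM/= mulrA -sqrtrM ?divr_ge0 ?pi_ge0 ?(ltW a0)//.
have -> : pi / a * (pi / (4 * a)^-1) = (2 * pi) ^+ 2 by field; rewrite gt_eqF.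
rewrite sqrtr_sqr ger0_norm ?mulr_ge0 ?pi_ge0//; congr (_ * expR _)%:C.
by rewrite subr0; field; rewrite gt_eqF.
Qed.

(** Constructive interference. Once the common factors are removed, the m-th term has a phase linear
    in m, a phase t L^2 m^2 and a small Gaussian correction. The quadratic phase is a multiple of 2
    pi, the hypothesis on [k] puts the linear one within 1/2 of 2 pi k m, and |y + 2 t w m| <= sqrt
    a keeps the point inside every Gaussian. Each real part is then at least 3/4 * 2/3 = 1/2, so
    nothing cancels. *)
Lemma normc_evol_ge t y (k : int) (p : nat) :
  0 <= t -> t <= a / 8 -> t * L ^+ 2 = 2 * pi * p%:R ->
  (forall m : 'I_K, (y + 2 * t * w m) ^+ 2 <= a) ->
  (forall m : 'I_K, `|L * (y + 2 * t * th) - 2 * pi * k%:~R| * m%:R <= 1 / 2) ->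
  K%:R * Num.sqrt (pi / a) / 4 <= normc (packet_evol t y).
Proof.
move=> t0 ta tL hy hk.
pose q := a ^+ 2 + t ^+ 2.
have q0 : 0 < q by rewrite /q ltr_pwDl ?exprn_gt0// sqr_ge0.
pose al := a / (4 * q); pose be := t / (4 * q).
pose ps (m : 'I_K) := (L * (y + 2 * t * th)) * m%:R + t * L ^+ 2 * m%:R ^+ 2 - be *
    (y + 2 * t * w m) ^+ 2.
pose S := \sum_(m < K) (expR (- al * (y + 2 * t * w m) ^+ 2))%:C * expi (ps m) : R[i].
have -> : packet_evol t y = expi (y * th + t * th ^+ 2) * gwave a t 0 * S.
  rewrite /packet_evol /S mulr_sumr; apply: eq_bigr => m _.
  rewrite gwaveE// -/q -/al -/be.
  rewrite (_ : y * w m + t * w m ^+ 2 = (y * th + t * th ^+ 2) + (ps m + be *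
      (y + 2 * t * w m) ^+ 2)); last first.
    by rewrite /ps /w; ring.
  rewrite !mulNr; move: (ps m) (be * _) (y * th + _) => u b v.
  rewrite expiD (expiD u); have e1 : expi b * expi (- b) = 1 :> R[i].
    by rewrite -expiD subrr expi0.
  by rewrite -[RHS]mulr1 -e1; ring.
rewrite !Normc.normcM normc_expi mul1r.
have hS : K%:R / 2 <= normc S.
  apply: le_trans (Re_le_normc _); apply: le_trans (ler_norm _).
  have -> : K%:R / 2 = \sum_(m < K)
      (1 / 2 : R) by rewrite sumr_const card_ord -[RHS]mulr_natl mul1r.
  rewrite /S raddf_sum/=; apply: ler_sum => m _.
  rewrite mul0r subr0.
  have cosE : cos (ps m) = cos ((L * (y + 2 * t * th) - 2 * pi * k%:~R) * m%:R - be *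
      (y + 2 * t * w m) ^+ 2).
    rewrite -[RHS](cosDint2pi _ (k * m%:Z + (p * m ^ 2)%N%:Z)); congr cos.
    rewrite /ps tL rmorphD rmorphM/= -!pmulrn natrM natrX; ring.
  have al1 : al * (y + 2 * t * w m) ^+ 2 <= 1 / 4.
    apply: (@le_trans _ _ (al * a)).
      by rewrite ler_wpM2l// divr_ge0 ?mulr_ge0 ?(ltW a0) ?(ltW q0).
    rewrite /al mulrAC ler_pdivrMr ?mulr_gt0// /q; have := sqr_ge0 t; nra.
  have be1 : be * (y + 2 * t * w m) ^+ 2 <= 1 / 32.
    apply: (@le_trans _ _ (be * a)).
      by rewrite ler_wpM2l// divr_ge0 ?mulr_ge0 ?(ltW a0) ?(ltW q0).
    rewrite /be mulrAC ler_pdivrMr ?mulr_gt0// /q; have := sqr_ge0 t; nra.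
  have be2 : 0 <= be * (y + 2 * t * w m) ^+ 2.
    by rewrite mulr_ge0 ?sqr_ge0// divr_ge0 ?mulr_ge0 ?(ltW q0).
  have ex : 3 / 4 <= expR (- al * (y + 2 * t * w m) ^+ 2).
    by apply: le_trans (expR_ge1Dx _); rewrite mulNr; lra.
  have cx : 2 / 3 <= cos (ps m).
    rewrite cosE; apply: le_trans (cos_ge_onem_sqr _).
    set X := (_ - _) * _ - _.
    (* 17/32 = 1/2 + 1/32, and 1 - (17/32)^2 > 2/3. *)
    have : `|X| <= 17 / 32.
      apply: (le_trans (ler_normB _ _)); rewrite (ger0_norm be2) normrM (ger0_norm (ler0n _ _)).
      have := hk m; lra.
    by rewrite ler_norml => /andP[X1 X2]; nra.
  have := ler_pM _ _ ex cx; rewrite !divr_ge0// => /(_ isT isT); lra.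
have hG := normc_gwave0_ge a0 t0 ta.
have := ler_pM _ _ hG hS; rewrite !divr_ge0 ?sqrtr_ge0// => /(_ isT isT) H.
by apply: le_trans H; rewrite le_eqVlt; apply/orP; left; apply/eqP; field.
Qed.

(** Almost orthogonality. The product of two Gaussians is [D m m'] times a Gaussian at the midpoint,
    and the spacing 2 K <= a L^2 makes every off-diagonal [D] at most 1 / K, so each row of the
    double sum is at most 2. The weight costs a factor 5: it is at most 3 + 2 (x - C)^2 / la^2
    around a centre with |C| <= la, and the quadratic term is absorbed by [sqr_gauss_le] since a
    la^2 >= 1. Together this is 10 K sqrt(pi / a). *)
Lemma packet_sqr_weight (la : R) : 0 < la -> 1 <= a * la ^+ 2 ->
  2 * K%:R <= a * L ^+ 2 ->
  (forall m : 'I_K, `|w m| <= la) ->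
  gdominated (fun x => (1 + x ^+ 2 / la ^+ 2) * packet x ^+ 2) /\
  \int[leb]_x ((1 + x ^+ 2 / la ^+ 2) * packet x ^+ 2) <= 10 * K%:R * Num.sqrt (pi / a).
Proof.
move=> la0 ala aL hw.
pose D (m m' : 'I_K) : R := expR (- (a / 2 * (w m - w m') ^+ 2)).
pose c (m m' : 'I_K) : R := (w m + w m') / 2.
pose bd x := \sum_(m < K) \sum_(m' < K) 5 * D m m' * gauss a (c m m') x.
have dbd : gdominated bd.
  apply: gdominated_sum => m; apply: gdominated_sum => m'; apply: gdominatedZ.
  exact: gdominated_gauss.
have le_bd x : (1 + x ^+ 2 / la ^+ 2) * packet x ^+ 2 <= bd x.
  rewrite [packet x ^+ 2]expr2 /packet big_distrlr/= mulr_sumr; apply: ler_sum => m _.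
  rewrite mulr_sumr; apply: ler_sum => m' _.
  have -> : gauss a (w m) x * gauss a (w m') x = D m m' * gauss (2 * a) (c m m') x.
    by rewrite /gauss /D -!expRD /c; congr expR; field.
  rewrite mulrCA (mulrC 5) -[D m m' * 5 * _]mulrA ler_wpM2l ?expR_ge0//.
  have g2 : gauss (2 * a) (c m m') x <= gauss a (c m m') x.
    by rewrite ler_expR ler_wpM2r ?sqr_ge0// lerN2 ler_peMl ?ler1n// ltW.
  have sg := sqr_gauss_le (c m m') x a0.
  have c2 : (c m m') ^+ 2 <= la ^+ 2.
    rewrite -[X in X <= _]real_normK ?num_real// ler_sqr ?nnegrE ?normr_ge0 ?(ltW la0)//.
    rewrite /c normrM (ger0_norm (_ : 0 <= 2^-1)) ?invr_ge0// ler_pdivrMr//.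
    by rewrite (le_trans (ler_normD _ _))// mulr_natr mulr2n lerD.
  have la2 : 0 < la ^+ 2 by rewrite exprn_gt0.
  set C := c m m' in g2 sg c2 *.
  have x2 : 1 + x ^+ 2 / la ^+ 2 <= 3 + 2 / la ^+ 2 * (x - C) ^+ 2.
    have : x ^+ 2 / la ^+ 2 <= 2 + 2 / la ^+ 2 * (x - C) ^+ 2.
      rewrite ler_pdivrMr// [leRHS](_ : _ = 2 * la ^+ 2 + 2 * (x - C) ^+ 2).
        by have := sqr_ge0 (x - C - C); nra.
      by field; rewrite gt_eqF.
    by move=> h; rewrite (_ : 3 = 1 + 2 :> R) ?natr1// -addrA lerD2l.
  apply: (@le_trans _ _ ((3 + 2 / la ^+ 2 * (x - C) ^+ 2) * gauss (2 * a) C x)).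
    by rewrite ler_wpM2r ?gauss_ge0.
  rewrite mulrDl -mulrA.
  have : 2 / la ^+ 2 * ((x - C) ^+ 2 * gauss (2 * a) C x) <= 2 * gauss a C x.
    apply: (@le_trans _ _ (2 / la ^+ 2 * (a^-1 * gauss a C x))).
      by rewrite ler_wpM2l// divr_ge0// ltW.
    rewrite -!mulrA ler_wpM2l// mulrA ler_piMl ?gauss_ge0//.
    by rewrite -invfM invf_le1 ?mulr_gt0// mulrC.
  move: (gauss (2 * a) C x) (gauss a C x) g2 (2 / la ^+ 2 * _) => u v uv z zv.
  by apply: le_trans (lerD (ler_wpM2l _ uv) zv) _ => //; rewrite -mulrDl -natrD.
have w0 x : 0 <= (1 + x ^+ 2 / la ^+ 2) * packet x ^+ 2.
  by rewrite mulr_ge0 ?sqr_ge0// addr_ge0// divr_ge0 ?sqr_ge0.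
have dF : gdominated (fun x => (1 + x ^+ 2 / la ^+ 2) * packet x ^+ 2).
  apply: gdominated_le dbd _.
    apply: measurable_funM; last by apply: measurable_funX; exact: gdominated_packet.1.
    by apply: measurable_funD => //; apply: measurable_funM.
  by move=> x; rewrite ger0_norm// (le_trans (le_bd x))// ler_norm.
split=> //.
apply: (@le_trans _ _ (\int[leb]_x bd x)).
  by apply: le_Rintegral => //; exact: gdominated_integrable.
have -> : \int[leb]_x bd x = \sum_(m < K) \sum_(m' < K) 5 * D m m' * Num.sqrt (pi / a).
  have dg m m' : gdominated (fun x => 5 * D m m' * gauss a (c m m') x).
    exact/gdominatedZ/gdominated_gauss.
  rewrite Rintegral_gdominated_sum; last by move=> m; exact: gdominated_sum.
  apply: eq_bigr => m _; rewrite Rintegral_gdominated_sum//; apply: eq_bigr => m' _.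
  by rewrite RintegralZl ?integral_gauss//; exact: integrable_gauss.
have DD m m' : D m m' <= (m == m')%:R + K%:R^-1.
  have K0 : 0 < K%:R :> R by rewrite ltr0n (leq_trans _ (ltn_ord m)).
  have [<-|mm'] := eqVneq m m'.
    by rewrite /D subrr expr0n mulr0 oppr0 expR0 lerDl invr_ge0 ltW.
  have h1 : 1 <= (m%:R - m'%:R) ^+ 2 :> R.
    have : (1 : int) <= (m%:Z - m'%:Z) ^+ 2.
      by rewrite -gtz0_ge1 exprn_even_gt0//= subr_eq0 eqz_nat.
    rewrite -(ler_int R) rmorphXn rmorphB/=; exact.
  rewrite add0r /D expRN lef_pV2 ?posrE ?expR_gt0//.
  apply: le_trans (expR_ge1Dx _); rewrite /w.
  have -> : th + L * m%:R - (th + L * m'%:R) = L * (m%:R - m'%:R) by ring.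
  rewrite exprMn mulrA.
  have h2 : K%:R <= a / 2 * L ^+ 2 by rewrite mulrAC ler_pdivlMr// mulrC.
  have : a / 2 * L ^+ 2 <= a / 2 * L ^+ 2 * (m%:R - m'%:R) ^+ 2.
    by rewrite ler_peMr// (le_trans _ h2)// ltW.
  lra.
apply: (@le_trans _ _ (\sum_(m < K) \sum_(m' < K) 5 * ((m == m')%:R + K%:R^-1) * Num.sqrt
    (pi / a))).
  apply: ler_sum => m _; apply: ler_sum => m' _.
  by rewrite ler_wpM2r ?sqrtr_ge0// ler_wpM2l.
rewrite (eq_bigr (fun=> 10 * Num.sqrt (pi / a))) => [|m _].
  by rewrite sumr_const card_ord -[leLHS]mulr_natr mulrAC.
rewrite -mulr_suml -mulr_sumr big_split/= sumr_const card_ord.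
rewrite (bigD1 m)//= eqxx big1 ?addr0; last by move=> i; rewrite eq_sym => /negPf ->.
have K0 : K%:R != 0 :> R by rewrite pnatr_eq0 -lt0n (leq_trans _ (ltn_ord m)).
have -> : K%:R^-1 *+ K = 1 :> R by rewrite -[LHS]mulr_natr mulVf.
by rewrite mulr1n; congr (_ * _); ring.
Qed.

End Packet.

(** * Tensor products of wave packets *)

Section Tensor.
Variables (R : realType) (N : nat).
Notation leb := (@lebesgue_measure R).
Notation mu := (lebesgueRn R N).
Notation RN := (Rn R N).

Lemma Rintegral_tensor (g : 'I_N -> R -> R) : (forall i, gdominated (g i)) ->
  mu.-integrable setT (EFin \o (fun x : RN => \prod_(i < N) g i (tnth x i))) /\
  \int[mu]_x (\prod_(i < N) g i (tnth x i)) = \prod_(i < N) \int[leb]_x g i x.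
Proof.
move=> dg; pose h i x : R[i] := (g i x)%:C.
have ih i : integrableC leb (h i) by exact/cgdominated_integrableC/cgdominated_real.
have ReE x : Re (\prod_(i < N) h i (tnth x i)) = \prod_(i < N) g i (tnth x i).
  by rewrite -rmorph_prod.
have [[ir _] e] := intC_tensor ih.
split.
  rewrite (_ : (fun _ => _) = (fun x : RN => Re (\prod_(i < N) h i (tnth x i))))//.
  by apply/funext => x; rewrite ReE.
have intE i : intC leb (h i) = (\int[leb]_x g i x)%:C.
  by rewrite /intC/= Rintegral_cst// mul0r.
move: e; rewrite (eq_bigr _ (fun i _ => intE i)) -rmorph_prod/=.
move=> /(congr1 (@complex.Re R)); rewrite /intC/= => <-.
by apply: eq_Rintegral => x _; rewrite -ReE.
Qed.

Lemma normc_prod (F : 'I_N -> R[i]) : normc (\prod_(i < N) F i) = \prod_(i < N) normc (F i).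
Proof. by apply: (big_morph _ (@Normc.normcM R)); exact: Normc.normc1. Qed.

Lemma expi_sum (p : 'I_N -> R) : expi (\sum_(i < N) p i) = \prod_(i < N) expi (p i).
Proof. by apply: (big_morph _ (@expiD R)); exact: expi0. Qed.

Lemma inLp_tensor (h : 'I_N -> R -> R[i]) : (forall i, cgdominated (h i)) ->
  inLp 1 (fun x : RN => \prod_(i < N) h i (tnth x i)) /\
  inLp 2 (fun x : RN => \prod_(i < N) h i (tnth x i)).
Proof.
move=> dh.
have mh : measurableC (fun x : RN => \prod_(i < N) h i (tnth x i)).
  by apply: cmeasurable_tensor => i; exact: (dh i).1.
have d1 i := gdominated_normc (dh i).
have d2 i := gdominatedM (d1 i) (d1 i).
have [/integrableP[_ i1] _] := Rintegral_tensor d1.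
have [/integrableP[_ i2] _] := Rintegral_tensor d2.
split; split => //; rewrite /LnormC.
  rewrite Lnorm1; apply: le_lt_trans i1; rewrite le_eqVlt; apply/orP; left; apply/eqP.
  by apply: eq_integral => x _; rewrite normc_prod.
rewrite unlock; apply: poweR_lty; apply: le_lt_trans i2.
rewrite le_eqVlt; apply/orP; left; apply/eqP; apply: eq_integral => x _.
rewrite /= powR_mulrn ?normr_ge0// normc_prod expr2 -normrM -big_split.
by congr (`| _ |)%:E.
Qed.

(** The constant sequence witnesses the closure. As the datum and its transform are in L^1 and L^2,
    both operators are evaluated on them as plain integrals. *)
Lemma L2_extension_refl (T : (RN -> R[i]) -> RN -> R[i]) f :
  inLp 1 f -> inLp 2 f -> inLp 2 (T f) -> L2_extension T f (T f).
Proof.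
move=> f1 f2 Tf2.
have L0 (g : RN -> R[i]) : L2_cvg (fun=> g) g.
  rewrite /L2_cvg (_ : (fun k : nat => _) = cst 0%E); first exact: cvg_cst.
  apply/funext => k /=; rewrite /LnormC (@eq_Lnorm _ _ _ mu _ _ (cst 0%E)) ?Lnorm0//.
  by move=> x; rewrite (subrr (g x)) Normc.normc0.
by split => //; exists (fun=> f); split => //; exact: L0.
Qed.

Lemma measurable_dotRn : measurable_fun setT (fun x : RN => dotRn x x).
Proof.
rewrite /dotRn; apply: measurable_sum => i.
by apply: measurable_funM; exact: measurable_tnth.
Qed.

Lemma measurable_unit_ball : measurable (unit_ball (R := R) (N := N)).
Proof.
rewrite (_ : unit_ball (N := N) = setT `&` (fun x : RN => dotRn x x) @^-1` `]-oo, 1[%classic).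
  by apply: measurable_dotRn => //; exact: measurable_itv.
by apply/seteqP; split => x /=; rewrite in_itv//= => -[].
Qed.

(* The supremum is at least V on E, so this is Chebyshev's inequality. *)
Lemma maximal_norm_ge (u : nat -> RN -> R[i]) (E : set RN) (V m : R) :
  (forall n, measurableC (u n)) -> measurable E -> E `<=` unit_ball (N := N) ->
  0 <= V -> (m%:E <= mu E)%E -> (forall x, E x -> exists n, V <= normc (u n x)) ->
  ((V ^+ 2 * m)%:E <= (Lnorm mu 2%:E
     ((fun x => ereal_sup [set (normc (u n x))%:E | n in setT]) \_ (unit_ball
         (N := N)))) `^ 2)%E.
Proof.
move=> mu_ mE EB V0 mE_ge hV.
rewrite poweR_Lnorm//.
set S := fun x => ereal_sup _.
have mS : measurable_fun setT S.
  have -> : S = fun x => esups (fun n => (normc (u n x))%:E) 0.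
    apply/funext => x; rewrite /S /esups /sdrop; congr ereal_sup.
    by apply/seteqP; split => _ [n _ <-]; exists n.
  by apply: measurable_fun_esups => n; apply/measurable_EFinP;
      exact: (cmeasurable_normc (mu_ n)).
have mSB : measurable_fun setT (S \_ (unit_ball (N := N))).
  have mSB : measurable_fun (unit_ball (N := N)) S.
    exact: (measurable_funS measurableT (@subsetT _ _) mS).
  exact: ((measurable_restrictT _ measurable_unit_ball).1 mSB).
apply: (@le_trans _ _ (\int[mu]_x ((V ^+ 2)%:E * (\1_E x)%:E))%E).
  rewrite ge0_integralZl ?lee_fin ?sqr_ge0//; last first.
    by apply/measurable_EFinP; exact: measurable_indic.
  by rewrite integral_indic// setIT EFinM lee_wpmul2l// lee_fin sqr_ge0.
apply: ge0_le_integral => //.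
- by move=> x _; rewrite mule_ge0// lee_fin ?sqr_ge0.
- by apply: measurable_funeM; apply/measurable_EFinP; exact: measurable_indic.
- apply: (measurableT_comp (measurable_poweR _)).
  exact: measurableT_comp.
move=> x _; rewrite indicE; case: (boolP (x \in E)) => xE; last first.
  by rewrite mule0 poweR_ge0.
rewrite mule1 patchE mem_set; last by apply: EB; exact: set_mem.
have [n Vn] := hV _ (set_mem xE).
have VS : (V%:E <= S x)%E.
  apply: (@le_trans _ _ (normc (u n x))%:E); first by rewrite lee_fin.
  by apply: ereal_sup_ubound; exists n.
rewrite gee0_abs; last by apply: le_trans VS; rewrite lee_fin.
rewrite -[V ^+ 2]powR_mulrn// -poweR_EFin.
by apply: gt0_ler_poweR; rewrite ?in_itv/= ?lee_fin ?V0 ?leey ?andbT// (le_trans _ VS).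
Qed.

End Tensor.

(** * The datum on R^N: evolution, Sobolev norm, consequence of the maximal estimate *)

Section PacketTensor.
Variables (R : realType) (N : nat).
Notation leb := (@lebesgue_measure R).
Notation mu := (lebesgueRn R N).
Notation RN := (Rn R N).
Variables (a th : 'I_N -> R) (L : R) (K : 'I_N -> nat).
Hypothesis a0 : forall i, 0 < a i.

Definition tsource (x : RN) : R[i] :=
  \prod_(i < N) packet_source (a i) (th i) L (K i) (tnth x i).

Definition tpacket (x : RN) : R := \prod_(i < N) packet (a i) (th i) L (K i) (tnth x i).

Definition tevol (t : R) (x : RN) : R[i] :=
  \prod_(i < N) packet_evol (a i) (th i) L (K i) t (tnth x i).

Let tpacketE : (fun x : RN => (tpacket x)%:C) =
  (fun x : RN => \prod_(i < N) (packet (a i) (th i) L (K i) (tnth x i))%:C).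
Proof. by apply/funext => x; rewrite rmorph_prod. Qed.

Let cgdominated_cpacket i : cgdominated (fun x => (packet (a i) (th i) L (K i) x)%:C).
Proof. by apply/cgdominated_real/gdominated_packet. Qed.

Lemma fourier_tsource : fourier_int tsource = (fun xi : RN => (tpacket xi)%:C).
Proof.
apply/funext => xi; rewrite /fourier_int.
have E : (fun x : RN => expi (- dotRn x xi) * tsource x) = (fun x : RN => \prod_(i < N)
    (expi (- (tnth x i * tnth xi i)) * packet_source (a i) (th i) L (K i) (tnth x i))).
  by apply/funext => x; rewrite big_split/= -expi_sum sumrN.
have ic i : integrableC leb (fun y =>
    expi (- (y * tnth xi i)) * packet_source (a i) (th i) L (K i) y).
  apply: cgdominated_integrableC; apply: cgdominated_expi; last exact: cgdominated_source.
  by apply: measurableT_comp => //; exact: measurable_funM.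
have [_] := intC_tensor ic; rewrite -E => h.
transitivity (((2 * pi) ^- N)%:C * intC mu (fun x : RN =>
    expi (- dotRn x xi) * tsource x)) => //.
rewrite h (eq_bigr (fun i => (2 * pi * packet (a i) (th i) L (K i) (tnth xi i))%:C)).
  rewrite -rmorph_prod big_split/= prodr_const card_ord -rmorphM/= mulrA mulVf ?mul1r//.
  by rewrite expf_neq0// mulf_neq0// gt_eqF// pi_gt0.
by move=> i _; rewrite intC_source.
Qed.

Lemma schrodinger_tpacket t : schrodinger_int t (fun xi : RN => (tpacket xi)%:C) = tevol t.
Proof.
apply/funext => x; rewrite /schrodinger_int.
have E : (fun xi : RN =>
    expi (dotRn x xi + t * dotRn xi xi) * (tpacket xi)%:C) = (fun xi : RN => \prod_(i < N)
    (expi (tnth x i * tnth xi i + t * tnth xi i ^+ 2) * (packet (a i) (th i) L (K i)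
        (tnth xi i))%:C)).
  apply/funext => xi; rewrite big_split/= -expi_sum big_split/= -mulr_sumr -rmorph_prod.
  by congr (expi (_ + _ * _) * _); apply: eq_bigr => i _; rewrite expr2.
have ic i : integrableC leb (fun y =>
    expi (tnth x i * y + t * y ^+ 2) * (packet (a i) (th i) L (K i) y)%:C).
  apply: cgdominated_integrableC; apply: cgdominated_expi => //.
  by apply: measurable_funD; apply: measurable_funM.
have [_] := intC_tensor ic; rewrite -E => h.
transitivity (intC mu (fun xi : RN =>
    expi (dotRn x xi + t * dotRn xi xi) * (tpacket xi)%:C)) => //.
by rewrite h; apply: eq_bigr => i _; rewrite intC_packet.
Qed.

Let Lp_source : inLp 1 tsource /\ inLp 2 tsource.
Proof. by apply: (inLp_tensor (h := fun i x => packet_source (a i) (th i) L (K i) x)) => i;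
    exact: cgdominated_source. Qed.

Let Lp_packet : inLp 1 (fun xi : RN => (tpacket xi)%:C) /\ inLp 2 (fun xi : RN =>
    (tpacket xi)%:C).
Proof. by rewrite tpacketE; exact: (inLp_tensor cgdominated_cpacket). Qed.

Let Lp_evol t : inLp 1 (tevol t) /\ inLp 2 (tevol t).
Proof. by apply: (inLp_tensor (h := fun i x => packet_evol (a i) (th i) L (K i) t x)) => i;
    exact: cgdominated_evol. Qed.

Lemma is_fourier_tsource : is_fourier tsource (fun xi : RN => (tpacket xi)%:C).
Proof.
rewrite -fourier_tsource; apply: L2_extension_refl; rewrite ?fourier_tsource.
- exact: Lp_source.1.
- exact: Lp_source.2.
- exact: Lp_packet.2.
Qed.

Lemma is_schrodinger_tsource t : is_schrodinger t tsource (tevol t).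
Proof.
exists (fun xi : RN => (tpacket xi)%:C); split; first exact: is_fourier_tsource.
rewrite -schrodinger_tpacket; apply: L2_extension_refl; rewrite ?schrodinger_tpacket.
- exact: Lp_packet.1.
- exact: Lp_packet.2.
- exact: (Lp_evol t).2.
Qed.

Section Sobolev.
Variables (la s : R).
Hypotheses (la1 : 1 <= la) (ala : forall i, 1 <= a i * la ^+ 2)
  (aL : forall i, 2 * (K i)%:R <= a i * L ^+ 2)
  (thla : forall i (m : 'I_(K i)), `|th i + L * m%:R| <= la)
  (s1 : s <= 1).

Let mass : R := \prod_(i < N) (10 * (K i)%:R * Num.sqrt (pi / a i)).

(* The product form of the weight keeps the integral below a product of
   one-dimensional integrals; s <= 1 makes it at most quadratic in each xi_i. *)
Let weight_le (xi : RN) :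
  (1 + dotRn xi xi) `^ s <= la `^ (2 * Num.max s 0) * \prod_(i < N)
      (1 + tnth xi i ^+ 2 / la ^+ 2).
Proof.
have la0 : 0 < la by apply: lt_le_trans la1.
have l2 : 1 <= la ^+ 2 by rewrite exprn_ege1.
have dot0 : 0 <= dotRn xi xi by apply: sumr_ge0 => i _; rewrite -expr2 sqr_ge0.
set P := \prod_(i < N) _.
have P1 : 1 + dotRn xi xi / la ^+ 2 <= P.
  rewrite /P /dotRn mulr_suml.
  pose F i := tnth xi i * tnth xi i / la ^+ 2.
  suff H (r : seq 'I_N) : 0 <= \sum_(i <- r) F i /\ 1 + \sum_(i <- r) F i <= \prod_(i <- r)
      (1 + tnth xi i ^+ 2 / la ^+ 2).
    exact: (H _).2.
  elim: r => [|i r [h0 h1]]; first by rewrite !big_nil addr0.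
  have F0 : 0 <= F i by rewrite /F -expr2 divr_ge0 ?sqr_ge0.
  rewrite !big_cons expr2 -/(F i); split; first exact: addr_ge0.
  apply: (@le_trans _ _ ((1 + F i) * (1 + \sum_(i <- r) F i))).
    by rewrite mulrDl mul1r mulrDr mulr1 [leLHS]addrA [leLHS]addrAC addrA lerDl mulr_ge0.
  by rewrite ler_wpM2l// addr_ge0.
have P0 : 1 <= P by apply: le_trans P1; rewrite lerDl divr_ge0// sqr_ge0.
set s' := Num.max s 0.
have s'0 : 0 <= s' by rewrite le_max lexx orbT.
have s'1 : s' <= 1 by rewrite ge_max s1 ler01.
apply: (@le_trans _ _ ((1 + dotRn xi xi) `^ s')).
  by apply: ler_powR; rewrite ?lerDl// le_max lexx.
apply: (@le_trans _ _ ((la ^+ 2 * P) `^ s')).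
  apply: ge0_ler_powR; rewrite ?nnegrE ?addr_ge0 ?mulr_ge0 ?(ltW la0) ?sqr_ge0// ?(le_trans
      ler01)//.
  apply: (@le_trans _ _ (la ^+ 2 * (1 + dotRn xi xi / la ^+ 2))).
    rewrite mulrDr mulr1 mulrC divfK ?lerD2r// gt_eqF// exprn_gt0//.
  by rewrite ler_wpM2l// sqr_ge0.
rewrite powRM ?sqr_ge0 ?(le_trans ler01)// -powR_mulrn ?(ltW la0)// -powRrM.
rewrite ler_wpM2l ?powR_ge0// -[leRHS]powRr1 ?(le_trans ler01)//.
exact: ler_powR.
Qed.

Lemma sobolev_tpacket :
  (sobolev_norm s (fun xi : RN =>
      (tpacket xi)%:C) `^ 2 <= (la `^ (2 * Num.max s 0) * mass)%:E)%E.
Proof.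
have la0 : 0 < la by apply: lt_le_trans la1.
have H i := packet_sqr_weight (a0 i) la0 (ala i) (aL i) (@thla i).
have dH i := (H i).1.
have [iF eF] := Rintegral_tensor dH.
have weight_ge0 i (x : R) : 0 <= (1 + x ^+ 2 / la ^+ 2) * packet (a i) (th i) L (K i) x ^+ 2.
  by rewrite mulr_ge0 ?sqr_ge0// addr_ge0// divr_ge0 ?sqr_ge0.
rewrite /sobolev_norm poweR_Lnorm//.
set F := fun x : RN => _ in iF eF.
have iF' : mu.-integrable setT (EFin \o (fun x => la `^ (2 * Num.max s 0) * F x)).
  by have := integrableZl measurableT (la `^ (2 * Num.max s 0)) iF.
apply: (@le_trans _ _ (\int[mu]_x (la `^ (2 * Num.max s 0) * F x)%:E)%E).
  apply: ge0_le_integral => //.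
  - by move=> x _; exact: poweR_ge0.
  - apply: (measurableT_comp (measurable_poweR _)); apply: measurableT_comp => //.
    apply/measurable_EFinP; apply: measurable_funM.
      apply: (measurableT_comp (measurable_powR _)).
      by apply: measurable_funD => //; exact: measurable_dotRn.
    exact: (cmeasurable_normc Lp_packet.1.1).
  - by case/integrableP : iF'.
  move=> x _; rewrite abse_EFin poweR_EFin lee_fin powR_mulrn//.
  rewrite -normrX ger0_norm ?sqr_ge0// exprMn -[_ ^+ 2 in X in X * _]powR_mulrn ?powR_ge0//.
  rewrite -powRrM mulfVK// normc_real real_normK ?num_real//.
  apply: (le_trans (ler_wpM2r _ (weight_le x))); first exact: sqr_ge0.
  by rewrite -mulrA ler_wpM2l ?powR_ge0// /F /tpacket big_split/= prodrXl.
under eq_integral do rewrite EFinM.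
rewrite integralZl// EFinM lee_wpmul2l ?lee_fin ?powR_ge0//.
rewrite -[leLHS]fineK; last by have := integrable_fin_num measurableT iF.
rewrite lee_fin; move: eF; rewrite /Rintegral => ->.
by apply: ler_prod => i _; rewrite (H i).2 andbT Rintegral_ge0.
Qed.

(** The datum is tested in the estimate. Finiteness of its Sobolev norm serves twice: as a
    hypothesis of the estimate, and to pass from extended reals to a squared inequality over R. *)
Lemma maximal_estimate_tpacket (t : nat -> R) (C : R) (E : set RN) (V m : R) :
  maximal_estimate N t s C -> measurable E -> E `<=` unit_ball (N := N) ->
  0 <= V -> (m%:E <= mu E)%E -> (forall x, E x -> exists n, V <= normc (tevol (t n) x)) ->
  V ^+ 2 * m <= C ^+ 2 * (la `^ (2 * Num.max s 0) * mass).
Proof.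
move=> hmax mE EB V0 mEge hV.
have sob2 := sobolev_tpacket.
set sob := sobolev_norm s _ in sob2.
have sob0 : (0 <= sob)%E by exact: Lnorm_ge0.
have soby : (sob < +oo)%E.
  rewrite ltey; apply/eqP => soby; move: sob2.
  by rewrite soby poweRyr// leye_eq.
have sobE : sob = (fine sob)%:E by rewrite fineK// ge0_fin_numE.
have := hmax _ _ _ is_fourier_tsource soby (fun n => is_schrodinger_tsource (t n)).
have := maximal_norm_ge (fun n => (Lp_evol (t n)).1.1) mE EB V0 mEge hV.
set X := Lnorm _ _ _; have X0 : (0 <= X)%E by exact: Lnorm_ge0.
rewrite -/sob sobE => hX XC.
have Xfin : X \is a fin_num by rewrite ge0_fin_numE// (le_lt_trans XC)// ltry.
move: X0 hX XC; rewrite -(fineK Xfin); move: (fine X) => x.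
rewrite lee_fin poweR_EFin lee_fin -EFinM lee_fin => x0; rewrite powR_mulrn// => hx xC.
move: sob2 sob0; rewrite sobE poweR_EFin !lee_fin => sob2 sob0.
rewrite powR_mulrn// in sob2.
apply: (le_trans hx); apply: (@le_trans _ _ ((C * fine sob) ^+ 2)).
  by rewrite ler_sqr ?nnegrE// (le_trans x0).
by rewrite exprMn ler_wpM2l// sqr_ge0.
Qed.

End Sobolev.
End PacketTensor.

(** * Geometry of the focusing sets *)

Section Comb.
Variable R : realType.
Notation leb := (@lebesgue_measure R).

(** The focusing set in one coordinate. Only [n] lattice points are kept, so that products of combs
    stay inside the unit ball. *)
Definition comb (n : nat) (h e c : R) : set R :=
  [set y | exists j : nat, (j < n)%N /\ `|y + c - j%:R * h| <= e].

Let tooth (h e c : R) (j : nat) : set R := `[j%:R * h - c - e, j%:R * h - c + e]%classic.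

Let combE n h e c : comb n h e c = \big[setU/set0]_(j < n) tooth h e c j.
Proof.
rewrite -bigcup_mkord; apply/seteqP; split => [y [j [jn yj]]|y [j /= jn]].
  exists j => //; rewrite /tooth /= in_itv/=; move: yj; rewrite ler_norml => /andP[? ?].
  by apply/andP; split; lra.
rewrite /tooth /= in_itv/= => /andP[? ?]; exists j; split => //.
by rewrite ler_norml; apply/andP; split; lra.
Qed.

Lemma measurable_comb n h e c : measurable (comb n h e c : set (measurableTypeR R)).
Proof. by rewrite combE; apply: bigsetU_measurable => j _; exact: measurable_itv. Qed.

Lemma lebesgue_comb n h e c : 0 <= e -> 2 * e < h ->
  leb (comb n h e c) = (n%:R * (2 * e))%:E.
Proof.
move=> e0 eh; rewrite combE measure_bigsetU.
- rewrite (eq_bigr (fun=> (2 * e)%:E)) => [|j _].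
    by rewrite sumEFin sumr_const card_ord -[X in X%:E = _]mulr_natl.
  apply: (etrans (lebesgue_measure_itv `[j%:R * h - c - e, j%:R * h - c + e])).
  rewrite /= lte_fin -EFinB.
  case: ltP => H; first by congr EFin; ring.
  by congr EFin; lra.
- by move=> j; exact: measurable_itv.
apply/trivIsetP => i j _ _ ij; apply/seteqP; split => // y [].
rewrite /tooth /= !in_itv/= => /andP[i1 i2] /andP[j1 j2].
have h0 : 0 < h by lra.
have [lij|lij] := ltnP i j.
  have : i%:R * h + h <= j%:R * h.
    by rewrite -[X in _ + X]mul1r -mulrDl natr1 ler_wpM2r ?ler_nat// ltW.
  lra.
have {}lij : (j < i)%N by rewrite ltn_neqAle eq_sym ij.
have : j%:R * h + h <= i%:R * h.
  by rewrite -[X in _ + X]mul1r -mulrDl natr1 ler_wpM2r ?ler_nat// ltW.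
lra.
Qed.

End Comb.

(* If every truncation D / K^i (0 < i < N) is within 1/K of an integer, then
   all base-K digits of D vanish. *)
Lemma digits_separated (K N D : nat) : (1 < K)%N -> (0 < D < K ^ N.-1)%N ->
  exists i, [/\ (0 < i < N)%N & forall m : int, (K%:Z ^+ i.-1 <= `|m * K%:Z ^+ i - D%:Z|)%R].
Proof.
move=> K1 /andP[D0 DK].
have ex : exists i, ~~ (K ^ i %| D)%N.
  by exists N.-1; apply/negP => /dvdn_leq -/(_ D0); rewrite leqNgt DK.
(* [i - 1] is the position of the lowest nonzero base-[K] digit: K^(i-1) divides D and K^i does
   not. *)
case: (ex_minnP ex) => i ndiv imin.
have i0 : (0 < i)%N by case: i ndiv {imin} => //; rewrite expn0 dvd1n.
have iN : (i < N)%N.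
  have : (i <= N.-1)%N by apply: imin; apply/negP => /dvdn_leq -/(_ D0); rewrite leqNgt DK.
  case: N DK {imin ex} => [|N _]; last by rewrite ltnS.
  by rewrite expn0 ltnS leqn0 => /eqP D00; rewrite D00 in D0.
exists i; split; first by rewrite i0.
move=> m.
have div : (K ^ i.-1 %| D)%N.
  by apply/negPn/negP => /imin; rewrite leqNgt prednK// leqnn.
have [q Dq] := dvdnP div.
have -> : m * K%:Z ^+ i - D%:Z = (m * K%:Z - q%:Z) * K%:Z ^+ i.-1.
  by rewrite Dq PoszM -(prednK i0) exprS /= mulrBl mulrA -!natz natrX.
rewrite normrM [X in _ <= _ * X]ger0_norm ?exprn_ge0//.
rewrite ler_peMl ?exprn_ge0// -gtz0_ge1 normr_gt0 subr_eq0.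
apply/eqP => mq; move/negP: ndiv; apply; rewrite Dq -(prednK i0) expnS /=.
apply: dvdn_mul => //.
have : (K%:Z %| q%:Z)%Z by rewrite -mq dvdz_mull.
by [].
Qed.

(** * One block of times: parameters, disjointness, lower bound *)

Section Geometry.
Variables (R : realType) (N K b : nat) (l0 : R).
Hypotheses (N0 : (0 < N)%N) (K1 : (1 < K)%N) (b1 : (1 <= b)%N)
  (l0_ge : 8 * b%:R * N%:R <= l0).
Notation RN := (Rn R N).
Notation mu := (lebesgueRn R N).
Notation leb := (@lebesgue_measure R).

Let k : R := K%:R.
Let Q : R := k ^+ N.
(** [B / l0] is the order of the spatial width of the packets with i > 0. At a focusing point, y + 2
    t th and 2 t L m are each at most 4 b / l0 in absolute value, hence the 8 b. *)
Let B : R := 8 * b%:R.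
Let ell : R := Q ^+ 2 * k * l0.
Let L : R := 2 * pi * ell.
Let la : R := 2 * pi * (Q ^+ 2 * k ^+ 2 * l0).

Let br1 : 1 <= b%:R :> R. Proof. by rewrite ler1n. Qed.
Let Nr1 : 1 <= N%:R :> R. Proof. by rewrite ler1n. Qed.
Let k2 : 2 <= k. Proof. by rewrite ler_nat. Qed.
Let k0 : 0 < k. Proof. by rewrite ltr0n (ltn_trans _ K1). Qed.
Let Qk : k <= Q. Proof. by rewrite /Q -{1}[k]expr1 ler_weXn2l// ler1n ltnW. Qed.
Let Q0 : 0 < Q. Proof. exact: exprn_gt0. Qed.
Let B8 : 8 <= B. Proof. by rewrite /B -[leLHS]mulr1 ler_wpM2l. Qed.
Let B0 : 0 < B. Proof. exact: lt_le_trans B8. Qed.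
Let l8 : B * N%:R <= l0. Proof. exact: l0_ge. Qed.
Let l0_gt0 : 0 < l0.
Proof. by apply: lt_le_trans l8; rewrite mulr_gt0// ltr0n. Qed.
Let ell0 : 0 < ell. Proof. by rewrite /ell !mulr_gt0// exprn_gt0. Qed.
Let pi0 := @pi_gt0 R.
Let pi2 : 2 <= pi :> R. Proof. exact: pi_ge2. Qed.
Let L0 : 0 < L. Proof. by rewrite /L !mulr_gt0. Qed.

Ltac abstract_field :=
  move: (Q0) (k0) (l0_gt0) (pi0); move: (Q) (k) (l0) (@pi R) => vQ vk vl vp vQ0 vk0 vl0 vp0;
  field; rewrite ?gt_eqF ?exprn_gt0 //.

(** When b^k = K^(2N) this is 2 b^(k+1) - (n + 1) at the global index n + 1 = b^k + d, the numerator
    in [times]. For d < K^(2N) both truncated subtractions are exact, b being positive. *)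
Definition block_num (d : nat) : nat := (2 * b * K ^ (2 * N) - K ^ (2 * N) - d)%N.
Definition block_time (d : nat) : R := (block_num d)%:R / (2 * pi * ell ^+ 2).

Let first (i : 'I_N) : bool := (i == 0 :> nat).
(** The first packet is narrower in space by Q k. Up to constants this is the most that [t <= a / 8]
    allows, the largest block time being comparable to (Q k l0)^-2. *)
Let sc i : R := if first i then Q * k else 1.
Let a i : R := (B / (l0 * sc i)) ^+ 2.
Let th i : R := if first i then pi * (Q ^+ 2 * k ^+ 2 * l0) else pi * ell / k ^+ i.
Let KK i : nat := if first i then 1%N else K.
(** For i > 0, the lattice points of step 1 / ell fill an interval of length 1 / l0. *)
Let nn i : nat := if first i then 1%N else (K ^ (2 * N) * K)%N.
Let hh i : R := if first i then 1 else ell^-1.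
(** For i > 0 an error [ee] changes the phase L y m by at most L * ee * k = 1/2, the amount allowed
    in [normc_evol_ge]. In the first coordinate two windows meet only if the numerators of their
    times differ by at most Q / (2 k), hence by less than K^(N-1). *)
Let ee i : R := if first i then (4 * l0 * Q * k)^-1 else (4 * pi * ell * k)^-1.
(* The focusing set at time block_time d: within ee i of the lattice hh i * Z,
   all frequencies of the i-th packet are in phase. *)
Let E (d : nat) : set RN :=
  [set x | forall i, comb (nn i) (hh i) (ee i) (2 * block_time d * th i) (tnth x i)].
Let rho d : R := (block_num d)%:R / Q ^+ 2.

Let sc0 i : 0 < sc i.
Proof. by rewrite /sc; case: ifP => // _; rewrite mulr_gt0. Qed.

Let sc_le i : sc i <= Q * k.
Proof.
rewrite /sc; case: ifP => // _.
by rewrite -[leLHS]mulr1 ler_pM//; [apply: le_trans Qk|]; move: k2; lra.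
Qed.

Let a0 i : 0 < a i.
Proof. by rewrite /a exprn_gt0// divr_gt0// mulr_gt0. Qed.

Let a_ge i : (B / (l0 * (Q * k))) ^+ 2 <= a i.
Proof.
have BB : 0 <= B by move: B8; lra.
rewrite /a ler_sqr ?nnegrE ?divr_ge0 ?mulr_ge0 ?(ltW l0_gt0) ?(ltW
    (sc0 i)) ?(ltW Q0) ?(ltW k0)//.
by rewrite ler_wpM2l// lef_pV2 ?posrE ?mulr_gt0// ler_wpM2l// ltW.
Qed.

Let rho_ge0 d : 0 <= rho d.
Proof. by rewrite divr_ge0// sqr_ge0. Qed.

Let rho_le d : rho d <= 2 * b%:R.
Proof.
rewrite ler_pdivrMr ?exprn_gt0// /Q -exprM -natrX -!natrM ler_nat (mulnC N).
exact: leq_trans (leq_subr _ _) (leq_subr _ _).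
Qed.

Let tE d : block_time d = rho d / (2 * pi * (Q ^+ 2 * k ^+ 2 * l0 ^+ 2)).
Proof.
rewrite /block_time /rho /ell; abstract_field.
Qed.

Let t_ge0 d : 0 <= block_time d.
Proof. by rewrite /block_time divr_ge0// mulr_ge0 ?sqr_ge0// mulr_ge0// ltW. Qed.

Let t_le d i : block_time d <= a i / 8.
Proof.
rewrite ler_pdivlMr//; apply: le_trans (a_ge i); rewrite tE.
have h0 : 0 < (l0 * (Q * k)) ^+ 2 by rewrite exprn_gt0// !mulr_gt0.
rewrite expr_div_n ler_pdivlMr// [leLHS](_ : _ = rho d * 4 / pi); last first.
  by abstract_field.
rewrite ler_pdivrMr//; apply: (@le_trans _ _ B).
  rewrite (_ : B = 2 * b%:R * 4); last by rewrite /B; ring.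
  by rewrite ler_wpM2r.
rewrite expr2 -mulrA -[leLHS]mulr1 ler_wpM2l ?(ltW B0)//.
by move: B8 pi2; move: (B) (@pi R) => u v; nra.
Qed.

Let tL d : block_time d * L ^+ 2 = 2 * pi * (block_num d)%:R.
Proof. by rewrite /block_time /L /ell; abstract_field. Qed.

(** Measured in lattice steps 1 / ell, the shift in a coordinate i > 0 is block_num / K^i; in the
    first coordinate it is 1 / (Q^2 l0) per unit of the numerator. *)
Let tth d i : 2 * block_time d * th i = rho d / l0 * (if first i then 1 else (k * k ^+ i)^-1).
Proof.
rewrite tE /th; case: ifP => _.
  by abstract_field.
by rewrite /ell; abstract_field.
Qed.

Let ell_inv : ell^-1 * (K ^ (2 * N) * K)%N%:R = l0^-1.
Proof.
rewrite natrM natrX -/k /ell (_ : k ^+ (2 * N) = Q ^+ 2); last by rewrite /Q -exprM mulnC.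
by abstract_field.
Qed.

Let ee_ge0 i : 0 <= ee i.
Proof. by rewrite /ee; case: ifP => _; rewrite invr_ge0 !mulr_ge0// ltW. Qed.

Let l0_le : l0^-1 <= 1 / 8.
Proof.
rewrite div1r lef_pV2 ?posrE//; apply: le_trans l8.
by rewrite -[leLHS]mulr1 ler_pM.
Qed.

Let ee_hh i : 2 * ee i < hh i.
Proof.
rewrite /ee /hh; case: ifP => _.
  rewrite (_ : 2 * _ = l0^-1 * (2 * (Q * k))^-1); last by abstract_field.
  apply: (@le_lt_trans _ _ (1 / 8 * 1)); last by lra.
  rewrite ler_pM ?invr_ge0 ?mulr_ge0 ?(ltW Q0) ?(ltW k0) ?(ltW l0_gt0)//.
  by rewrite invf_le1 ?mulr_gt0//; move: Qk k2; move: (Q) (k) => q x; nra.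
rewrite (_ : 2 * _ = ell^-1 * (2 * pi * k)^-1); last by rewrite /ell; abstract_field.
rewrite gtr_pMr ?invr_gt0// invf_lt1 ?mulr_gt0//.
by move: pi2 k2; move: (@pi R) (k) => p x; nra.
Qed.

Let ee_le i : ee i <= l0^-1.
Proof.
rewrite /ee; case: ifP => _; rewrite lef_pV2 ?posrE ?mulr_gt0//.
  rewrite -mulrA (mulrC 4) -mulrA ler_peMr ?(ltW l0_gt0)//.
  by move: Qk k2; move: (Q) (k) => q x; nra.
rewrite (_ : _ * ell * k = l0 * (4 * pi * (Q ^+ 2) * k ^+ 2)); last by rewrite /ell; ring.
rewrite ler_peMr ?(ltW l0_gt0)//.
have h1 : 1 <= Q ^+ 2 by rewrite exprn_ege1// (le_trans _ Qk)// (le_trans _ k2)// ler1n.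
have h2 : 1 <= k ^+ 2 by rewrite exprn_ege1// (le_trans _ k2)// ler1n.
have h3 : 1 <= 4 * pi :> R by move: pi2; lra.
by rewrite mulr_ege1// mulr_ege1.
Qed.

Let measurable_E d : measurable (E d).
Proof.
rewrite (_ : E d = \bigcap_(i in [set: 'I_N]) (setT `&` (fun x : RN => tnth x i) @^-1`
    (comb (nn i) (hh i) (ee i) (2 * block_time d * th i) : set (measurableTypeR R)))).
  apply: fin_bigcap_measurable => // i _.
  by apply: measurable_tnth => //; exact: measurable_comb.
by apply/seteqP; split => x /= H i; [move=> _; split=> //; exact: H|exact: (H i Logic.I).2].
Qed.

Let mu_E d : mu (E d) = (\prod_(i < N) ((nn i)%:R * (2 * ee i)))%:E.
Proof.
have h := lebesgueRn_box (fun i =>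
    @measurable_comb R (nn i) (hh i) (ee i) (2 * block_time d * th i)).
apply: (etrans h); rewrite -prodEFin; apply: eq_bigr => i _.
by rewrite lebesgue_comb.
Qed.

Let E_phase d x i : E d x -> exists j : nat,
  [/\ (j < nn i)%N, `|tnth x i + 2 * block_time d * th i - j%:R * hh i| <= ee i &
      - l0^-1 <= tnth x i + 2 * block_time d * th i <= 2 / l0].
Proof.
move=> /(_ i) [j [jn hj]]; exists j; split => //.
have e1 := ee_le i.
have j0 : 0 <= j%:R * hh i.
  by rewrite mulr_ge0// /hh; case: ifP => _ //; rewrite invr_ge0 ltW.
have j1 : j%:R * hh i <= l0^-1.
  move: jn; rewrite /nn /hh; case: ifP => _.
    by rewrite ltnS leqn0 => /eqP ->; rewrite mul0r invr_ge0 ltW.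
  by move=> jn; rewrite -ell_inv mulrC ler_wpM2l ?invr_ge0 ?(ltW ell0)// ler_nat ltnW.
move: hj; rewrite ler_norml => /andP[h1 h2].
have : 2 / l0 = l0^-1 + l0^-1 by rewrite mulr_natl mulr2n.
have aux (X e z v w : R) : 0 <= z -> z <= v -> e <= v -> - e <= X - z -> X - z <= e ->
    w = v + v -> - v <= X <= w by move=> *; apply/andP; split; lra.
exact: aux j0 j1 e1 h1 h2.
Qed.

Let tth_bound d i : 0 <= 2 * block_time d * th i <= 2 * b%:R / l0.
Proof.
rewrite tth; have f0 : 0 <= rho d / l0 by rewrite divr_ge0// ltW.
have f1 : rho d / l0 <= 2 * b%:R / l0 by rewrite ler_wpM2r// invr_ge0 ltW.
case: ifP => _; first by rewrite mulr1 f0 f1.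
have ki : 0 < k * k ^+ i by rewrite mulr_gt0// exprn_gt0.
rewrite mulr_ge0 ?invr_ge0 ?(ltW ki)//=; apply: le_trans f1.
rewrite ler_piMr// invf_le1// -exprS exprn_ege1//.
by apply: le_trans k2; rewrite ler1n.
Qed.

(** Every coordinate is at most B / (2 l0) <= 1 / (2 N) in absolute value; this is where the
    condition 8 b N <= l0 comes from. *)
Let E_ball d : E d `<=` unit_ball (N := N).
Proof.
move=> x Ex; rewrite /unit_ball /dotRn /=.
have xi i : `|tnth x i| <= B / (2 * l0).
  have [j [_ _]] := E_phase i Ex; have := tth_bound d i.
  have : 2 / l0 <= 2 * b%:R / l0.
    by rewrite ler_wpM2r ?invr_ge0 ?(ltW l0_gt0)// -[leLHS]mulr1 ler_wpM2l.
  have -> : B / (2 * l0) = 2 * b%:R / l0 + 2 * b%:R / l0 by rewrite /B; abstract_field.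
  have li : 0 <= l0^-1 by rewrite invr_ge0 ltW.
  have -> : 2 / l0 = l0^-1 + l0^-1 by rewrite mulr_natl mulr2n.
  move: (2 * block_time d * th i) (tnth x i) (2 * b%:R / l0) (l0^-1) li => u y v w.
  move=> w0 wv /andP[u0 uv] /andP[y1 y2]; rewrite ler_norml; apply/andP; split; lra.
have BN : B / (2 * l0) <= (2 * N%:R)^-1.
  rewrite ler_pdivrMr ?mulr_gt0// mulrC ler_pdivlMr ?mulr_gt0 ?ltr0n//.
  by rewrite mulrCA ler_pM2l.
apply: (@le_lt_trans _ _ (\sum_(i < N) (2 * N%:R)^-1 ^+ 2)).
  apply: ler_sum => i _; rewrite -expr2 -real_normK ?num_real//.
  by rewrite ler_sqr ?nnegrE ?invr_ge0 ?mulr_ge0// (le_trans (xi i)).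
rewrite sumr_const card_ord -[ltLHS]mulr_natr exprVn ltr_pdivrMl ?exprn_gt0 ?mulr_gt0
    ?ltr0n// mulr1.
by move: Nr1; move: (N%:R) => n n1; nra.
Qed.

(** At a common point the first coordinate forces 0 < D < K^(N-1) for the difference D of the
    numerators, and every other coordinate places D / K^i within 1 / (2 pi K) of an integer, the
    difference of the two tooth numbers. By [digits_separated] the distance is at least 1 / K for
    some i. *)
Let E_disjoint d d' x : (d < K ^ (2 * N))%N -> (d' < K ^ (2 * N))%N ->
  E d x -> E d' x -> d = d'.
Proof.
wlog dd' : d d' / (d < d')%N.
  move=> H hd hd' Ed Ed'; case: (ltngtP d d') => [h|h|//].
    exact: (H _ _ h hd hd' Ed Ed').
  by rewrite (H _ _ h hd' hd Ed' Ed).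
move=> _ hd' Ed Ed'; exfalso.
pose D := (d' - d)%N.
have rhoD : rho d - rho d' = D%:R / Q ^+ 2.
  rewrite /rho -mulrBl; congr (_ / _).
  have dT : (d' <= 2 * b * K ^ (2 * N) - K ^ (2 * N))%N.
    apply: (leq_trans (ltnW hd')).
    by rewrite -{3}[(K ^ _)%N]mul1n -mulnBl leq_pmull// subn_gt0 mul2n -addnn (leq_add b1 b1).
  rewrite /block_num /D; move: (_ - _)%N dT => T dT.
  by rewrite (natrB _ dT) (natrB _ (leq_trans (ltnW dd') dT)) (natrB _ (ltnW dd')); ring.
have DK : (0 < D < K ^ N.-1)%N.
  rewrite subn_gt0 dd'/=.
  have [j [jn hj _]] := E_phase (Ordinal N0) Ed.
  have [j' [jn' hj' _]] := E_phase (Ordinal N0) Ed'.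
  move: jn jn' hj hj'; rewrite /nn/= !ltnS !leqn0 => /eqP -> /eqP ->.
  rewrite !tth /= !mulr1 ?mulr0n ?mul0r !subr0 /ee /=.
  move=> hj hj'.
  have : `|(rho d - rho d') / l0| <= 2 * (4 * l0 * Q * k)^-1.
    rewrite (_ : _ / l0 = (tnth x (Ordinal N0) + rho d / l0) - (tnth x
        (Ordinal N0) + rho d' / l0)); last by ring.
    by apply: (le_trans (ler_normB _ _)); rewrite [leRHS]mulr_natl mulr2n lerD.
  rewrite rhoD ger0_norm ?divr_ge0 ?sqr_ge0 ?(ltW l0_gt0)// => h.
  rewrite -(ltr_nat R) natrX -/k.
  have -> : k ^+ N.-1 = Q / k by rewrite /Q -[in RHS](prednK N0) exprS mulrAC divff ?mul1r
      ?gt_eqF.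
  apply: (@le_lt_trans _ _ (Q / k / 2));
      last by rewrite ltr_pdivrMr// ltr_pMr ?divr_gt0// ltr1n.
  have := ler_wpM2r (ltW (mulr_gt0 l0_gt0 (exprn_gt0 2 Q0))) h.
  rewrite [leLHS](_ : _ = D%:R); last by move: (D%:R) => P; abstract_field.
  by rewrite [leRHS](_ : _ = Q / k / 2)//; abstract_field.
have [i [/andP[i0 iN] hm]] := digits_separated K1 DK.
have [j [_ hj _]] := E_phase (Ordinal iN) Ed.
have [j' [_ hj' _]] := E_phase (Ordinal iN) Ed'.
have fi : first (Ordinal iN) = false by rewrite /first/= gtn_eqF.
move: hj hj'; rewrite !tth fi /hh fi /ee fi /= => hj hj'.
have ki0 : 0 < k ^+ i by rewrite exprn_gt0.
have h : `|(rho d - rho d') / l0 * (k * k ^+ i)^-1 - (j%:R - j'%:R) * ell^-1| <= 2 *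
    (4 * pi * ell * k)^-1.
  rewrite (_ : _ - _ = (tnth x (Ordinal iN) + rho d / l0 * (k * k ^+ i)^-1 - j%:R * ell^-1) -
     (tnth x (Ordinal iN) + rho d' / l0 * (k * k ^+ i)^-1 - j'%:R * ell^-1)); last by ring.
  by apply: (le_trans (ler_normB _ _)); rewrite [leRHS]mulr_natl mulr2n lerD.
have := hm (j%:Z - j'%:Z); rewrite -(ler_int R) => hm'.
have : k ^+ i.-1 <= `|(j%:R - j'%:R) * k ^+ i - D%:R|.
  by move: hm'; rewrite intr_norm rmorphB rmorphM rmorphB !rmorphXn/=.
apply/negP; rewrite -ltNge.
have -> : (j%:R - j'%:R) * k ^+ i - D%:R =
    - (((rho d - rho d') / l0 * (k * k ^+ i)^-1 - (j%:R - j'%:R) * ell^-1) * (ell * k ^+ i)).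
  rewrite rhoD /ell; move: (k ^+ i) ki0 (D%:R) (j%:R) (j'%:R) => u u0 P J J'.
  by abstract_field.
rewrite normrN normrM (ger0_norm (ltW (mulr_gt0 ell0 ki0))).
apply: (le_lt_trans (ler_wpM2r (ltW (mulr_gt0 ell0 ki0)) h)).
have -> : k ^+ i = k * k ^+ i.-1 by rewrite -exprS prednK.
rewrite [ltLHS](_ : _ = k ^+ i.-1 / (2 * pi)).
  by rewrite ltr_pdivrMr ?mulr_gt0// ltr_pMr ?exprn_gt0//; move: pi2; lra.
by rewrite /ell; move: (k ^+ i.-1) => u; abstract_field.
Qed.

Let phase_bound d i (m : 'I_(KK i)) : ~~ first i ->
  0 <= 2 * block_time d * (L * m%:R) <= 4 * b%:R / l0.
Proof.
move=> fi; rewrite mulrA; have tL0 : 0 <= 2 * block_time d * L.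
  by rewrite mulr_ge0 ?(ltW L0)// mulr_ge0 ?t_ge0.
rewrite mulr_ge0//=; apply: (@le_trans _ _ (2 * block_time d * L * k)).
  by rewrite ler_wpM2l// ler_nat ltnW//; case: m => /= m; rewrite /KK (negbTE fi).
rewrite tE /L /ell [leLHS](_ : _ = 2 * (rho d / l0)); last by abstract_field.
rewrite (_ : 4 * b%:R / l0 = 2 * (2 * b%:R / l0)); last by ring.
by rewrite ler_wpM2l// ler_wpM2r// invr_ge0 ltW.
Qed.

Let sqrt_a i : Num.sqrt (pi / a i) = Num.sqrt pi * (l0 * sc i / B).
Proof.
rewrite /a sqrtrM ?(ltW pi0)// -exprVn sqrtr_sqr invf_div ger0_norm//.
by rewrite divr_ge0 ?mulr_ge0 ?(ltW l0_gt0) ?(ltW (sc0 i)) ?(ltW B0).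
Qed.

Let evol_ge d x : E d x ->
  \prod_(i < N) ((KK i)%:R * Num.sqrt (pi / a i) / 4) <= normc (tevol a th L KK
      (block_time d) x).
Proof.
move=> Ex; rewrite /tevol normc_prod; apply: ler_prod => i _.
rewrite divr_ge0 ?mulr_ge0 ?sqrtr_ge0//=.
have [j [jn hj h]] := E_phase i Ex.
have m_first (m : 'I_(KK i)) : first i -> m%:R = 0 :> R.
  by move=> fi; case: m => m /=; rewrite /KK fi ltnS leqn0 => /eqP ->.
apply: (@normc_evol_ge _ _ _ _ _ (a0 i) _ _ j%:Z (block_num d)) => //.
- move=> m; rewrite /a -real_normK ?num_real// ler_sqr ?nnegrE//; last first.
    by rewrite divr_ge0 ?mulr_ge0 ?(ltW l0_gt0) ?(ltW (sc0 i)) ?(ltW B0).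
  have [fi|fi] := boolP (first i).
    rewrite (m_first m fi) mulr0 addr0.
    move: hj; rewrite /hh fi /ee fi; move: jn; rewrite /nn fi ltnS leqn0 => /eqP ->.
    rewrite mul0r subr0 => /le_trans; apply; rewrite /sc fi.
    rewrite -[leLHS]mul1r ler_pM ?invr_ge0 ?mulr_ge0 ?(ltW Q0) ?(ltW k0) ?(ltW l0_gt0)//.
      by apply: le_trans B8; rewrite ler1n.
    rewrite lef_pV2 ?posrE ?mulr_gt0// -!mulrA ler_peMl ?ler1n//.
    by rewrite ltW// !mulr_gt0.
  rewrite /sc (negbTE fi) mulr1.
  have := phase_bound d m fi; move: h.
  have -> : B / l0 = 4 * b%:R / l0 + 4 * b%:R / l0 by rewrite /B; abstract_field.
  rewrite [2 * block_time d * (th i + _)]mulrDr addrA.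
  have : 2 / l0 <= 4 * b%:R / l0.
    rewrite ler_wpM2r ?invr_ge0 ?(ltW l0_gt0)// (@le_trans _ _ 4) ?ler_nat//.
    by rewrite -[leLHS]mulr1 ler_wpM2l.
  have li : 0 <= l0^-1 by rewrite invr_ge0 ltW.
  have -> : 2 / l0 = l0^-1 + l0^-1 by rewrite mulr_natl mulr2n.
  have aux (y u v w : R) : 0 <= w -> w + w <= v -> - w <= y <= w + w ->
      0 <= u <= v -> `|y + u| <= v + v.
    by move=> w0 wv /andP[y1 y2] /andP[u1 u2]; rewrite ler_norml; apply/andP; split; lra.
  exact: aux li.
- move=> m; have [fi|fi] := boolP (first i).
    by rewrite (m_first m fi) mulr0 divr_ge0.
  move: hj; rewrite /hh /ee (negbTE fi) => hj.
  rewrite (_ : _ - _ = L * (tnth x i + 2 * block_time d * th i - j%:R * ell^-1)); last first.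
    rewrite -pmulrn mulrBr; congr (_ - _); rewrite /L.
    by move: (ell) ell0 (@pi R) (j%:R) => v v0 p J; field; rewrite gt_eqF.
  rewrite normrM (ger0_norm (ltW L0)).
  apply: (@le_trans _ _ (L * (4 * pi * ell * k)^-1 * k)).
    apply: ler_pM => //; first by rewrite mulr_ge0// ltW.
      by rewrite ler_wpM2l// ltW.
    by rewrite ler_nat ltnW//; case: m => /= m; rewrite /KK (negbTE fi).
  rewrite le_eqVlt; apply/orP; left; apply/eqP; rewrite /L /ell; abstract_field.
Qed.

(** A lower bound, per coordinate, for the captured mass over the weighted mass: 1/80 is (1/4)^2 * 2
    / 10, the factor 4 pi comes from [ee], and 1 / B from the width of the packet. *)
Let c1 : R := (4 * 80 * pi * B)^-1.

Let ratio i : c1 * (10 * (KK i)%:R * Num.sqrt (pi / a i)) <=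
  ((KK i)%:R * Num.sqrt (pi / a i) / 4) ^+ 2 * ((nn i)%:R * (2 * ee i)).
Proof.
have KK0 : 0 < (KK i)%:R :> R by rewrite ltr0n /KK; case: ifP => // _; exact: ltn_trans K1.
set S := Num.sqrt _.
have S0 : 0 < S by rewrite sqrtr_gt0 divr_gt0.
rewrite [leRHS](_ : _ = ((nn i)%:R * ee i * (KK i)%:R * S / 80) * (10 * (KK i)%:R * S));
    last by field.
rewrite ler_wpM2r ?mulr_ge0 ?(ltW S0)// /S sqrt_a.
have sp : 1 <= Num.sqrt pi :> R.
  by rewrite -[leLHS]sqrtr1 ler_wsqrtr// (le_trans _ pi2)// ler1n.
have q0 : 0 < 80 :> R by rewrite ltr0n.
rewrite /c1 /nn /ee /KK /sc; move: (80 : R) q0 => q q0; case: ifP => fi.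
  rewrite [leRHS](_ : _ = Num.sqrt pi / (4 * q * B)); last first.
    by move: (Num.sqrt _) (B) B0 => u v v0; abstract_field.
  have hB : 0 < 4 * q * B by rewrite mulr_gt0// mulr_gt0.
  have hpB : 0 < 4 * q * pi * B by rewrite mulr_gt0// mulr_gt0// mulr_gt0.
  rewrite -[leLHS]mul1r; apply: ler_pM => //; first by rewrite invr_ge0 ltW.
  rewrite lef_pV2 ?posrE// [leRHS]mulrAC ler_peMr ?(ltW hB)//.
  by rewrite (le_trans _ pi2)// ler1n.
rewrite [leRHS](_ : _ = Num.sqrt pi / (4 * q * pi * B)); last first.
  have -> : (K ^ (2 * N) * K)%N%:R = Q ^+ 2 * k by rewrite natrM natrX /Q -exprM (mulnC N).
  by rewrite -/k /ell; move: (Num.sqrt _) (B) B0 => u v v0; abstract_field.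
have hpB : 0 < 4 * q * pi * B by rewrite mulr_gt0// mulr_gt0// mulr_gt0.
by rewrite -[leLHS]mul1r ler_wpM2r// invr_ge0 ltW.
Qed.

(** Each of the K^(2N) disjoint focusing sets captures at least the fraction [c1 ^ N] of [mass], so
    their union captures K^(2N) times as much. Dividing by [mass] leaves nothing of the datum but
    its frequency bound [la]. *)
Lemma block_lower_bound (t : nat -> R) (s C : R) : s <= 1 ->
  (forall d, (d < K ^ (2 * N))%N -> exists n, t n = block_time d) ->
  maximal_estimate N t s C ->
  (4 * 80 * pi * (8 * b%:R))^-1 ^+ N * (k ^+ N) ^+ 2 <=
    C ^+ 2 * (2 * pi * ((k ^+ N) ^+ 2 * k ^+ 2 * l0)) `^ (2 * Num.max s 0).
Proof.
move=> s1 ht hmax.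
pose M := (K ^ (2 * N))%N.
pose U := \big[setU/set0]_(d < M) E d.
pose V : R := \prod_(i < N) ((KK i)%:R * Num.sqrt (pi / a i) / 4).
pose e : R := \prod_(i < N) ((nn i)%:R * (2 * ee i)).
have mU : measurable U by apply: bigsetU_measurable => d _; exact: measurable_E.
have muU : ((M%:R * e)%:E <= mu U)%E.
  rewrite /U measure_semi_additive_ord_I.
  - rewrite (eq_bigr (fun=> e%:E)) => [|d _]; last exact: mu_E.
    by rewrite sumEFin sumr_const card_ord mulr_natl.
  - by move=> d _; exact: measurable_E.
  - apply/trivIsetP => d d' /= dM d'M; apply: contra_neqP => /eqP/set0P[x [Ed Ed']].
    exact: E_disjoint Ed Ed'.
  - exact: mU.
have UE x : U x -> exists2 d, (d < M)%N & E d x.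
  by rewrite /U -bigcup_mkord => -[d /= dM Ed]; exists d.
have UB : U `<=` unit_ball (N := N) by move=> x /UE[d _]; exact: E_ball.
have V0 : 0 <= V.
  by apply: prodr_ge0 => i _; rewrite divr_ge0// mulr_ge0// sqrtr_ge0.
have hV x : U x -> exists n, V <= normc (tevol a th L KK (t n) x).
  by move=> /UE[d dM Ed]; have [n tn] := ht d dM; exists n; rewrite tn; exact: evol_ge.
have l01 : 1 <= l0.
  by apply: le_trans l8; rewrite -[leLHS]mulr1 ler_pM// (le_trans _ B8)// ler1n.
have k1 : 1 <= k by apply: le_trans k2; rewrite ler1n.
have Q1 : 1 <= Q by apply: le_trans Qk.
have pi1 : 1 <= pi :> R by apply: le_trans pi2; rewrite ler1n.
have B1 : 1 <= B by apply: le_trans B8; rewrite ler1n.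
have K0 : (0 < K)%N := ltnW K1.
have la1 : 1 <= la.
  by rewrite /la; do ?[apply: mulr_ege1]; rewrite ?exprn_ege1 ?ler1n.
have ala i : 1 <= a i * la ^+ 2.
  apply: (@le_trans _ _ ((B / (l0 * (Q * k))) ^+ 2 * la ^+ 2));
      last by rewrite ler_wpM2r ?sqr_ge0.
  rewrite -exprMn exprn_ege1// (_ : _ * la = 2 * pi * (B * (Q * k))).
    by do ?[apply: mulr_ege1]; rewrite ?ler1n.
  by rewrite /la; move: (B) => v; abstract_field.
have aL i : 2 * (KK i)%:R <= a i * L ^+ 2.
  apply: (@le_trans _ _ ((B / (l0 * (Q * k))) ^+ 2 * L ^+ 2));
      last by rewrite ler_wpM2r ?sqr_ge0.
  rewrite -exprMn (_ : _ * L = 2 * pi * B * Q); last first.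
    by rewrite /L /ell; move: (B) => v; abstract_field.
  apply: (@le_trans _ _ (2 * Q)).
    by rewrite ler_wpM2l// (le_trans _ Qk)// ler_nat /KK; case: ifP => // _.
  have pB : 2 <= 2 * pi * B by move: pi2 B8; move: (@pi R) (B) => u v; nra.
  by rewrite expr2 ler_pM// ?(ltW Q0)//; move: pB Q1; move: (2 * pi * B) (Q) => u v; nra.
have p1 : 0 < Q ^+ 2 * k ^+ 2 * l0 by rewrite !mulr_gt0// exprn_gt0.
have thla i (m : 'I_(KK i)) : `|th i + L * m%:R| <= la.
  have th0 : 0 <= th i.
    rewrite /th; case: ifP => _; first by rewrite ltW ?mulr_gt0.
    by rewrite ltW// divr_gt0 ?mulr_gt0// exprn_gt0.
  have Lm : 0 <= L * m%:R by rewrite mulr_ge0// ltW.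
  rewrite (ger0_norm (addr_ge0 th0 Lm)).
  have laE : la = L * k by rewrite /la /L /ell; ring.
  have mK := ltn_ord m; move: (nat_of_ord m) mK {Lm} => {}m.
  rewrite /KK /th; case: ifP => fi.
    rewrite ltnS leqn0 => /eqP ->; rewrite mulr0 addr0 /la -[2 * pi * _]mulrA ler_peMl ?ler1n//.
    by rewrite ltW ?mulr_gt0.
  move=> mK; have m1 : 1 + m%:R <= k by rewrite nat1r ler_nat.
  apply: (@le_trans _ _ (L * (1 + m%:R))); last by rewrite laE ler_wpM2l// ltW.
  rewrite mulrDr mulr1 lerD2r /L; apply: (@le_trans _ _ (pi * ell)).
    rewrite ler_pdivrMr ?exprn_gt0//; apply: ler_peMr; first by rewrite ltW ?mulr_gt0.
    exact: exprn_ege1.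
  by rewrite -mulrA; apply: ler_peMl; rewrite ?ler1n// ltW ?mulr_gt0.
have := maximal_estimate_tpacket a0 la1 ala aL thla s1 hmax mU UB V0 muU hV.
set mass := \prod_(i < N) _ => H.
have KK0 i : 0 < (KK i)%:R :> R by rewrite ltr0n /KK; case: ifP => // _; exact: ltn_trans K1.
have mass0 : 0 < mass.
  by apply: prodr_gt0 => i _; rewrite mulr_gt0 ?mulr_gt0// sqrtr_gt0 divr_gt0.
have H2 : c1 ^+ N * mass <= V ^+ 2 * e.
  rewrite (_ : c1 ^+ N = \prod_(i < N) c1); last by rewrite prodr_const card_ord.
  rewrite /V /mass /e -prodrXl -!big_split/=; apply: ler_prod => i _.
  rewrite ratio andbT mulr_ge0 ?mulr_ge0 ?sqrtr_ge0// /c1 invr_ge0.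
  by rewrite mulr_ge0 ?(ltW B0)// mulr_ge0// ltW.
rewrite -(ler_pM2r mass0) -[leRHS]mulrA; apply: le_trans H.
have -> : M%:R = Q ^+ 2 by rewrite /M natrX -/k /Q -exprM mulnC.
rewrite -/Q -/B -/c1 mulrAC [leRHS]mulrCA [leRHS]mulrC ler_wpM2r ?sqr_ge0//.
Qed.

End Geometry.

(** * The sequence of times *)

Section WeakDecay.
Variables (R : realType) (r c : R) (t : nat -> R).
Hypotheses (r0 : 0 < r) (t0 : forall n, 0 < t n)
  (tc : forall n, t n `^ r * n.+1%:R <= c).

Let few (e : R) n : 0 < e -> e <= t n -> n.+1%:R <= c / e `^ r.
Proof.
move=> e0 et; rewrite ler_pdivlMr ?powR_gt0// mulrC; apply: le_trans (tc n).
by rewrite ler_wpM2r// ge0_ler_powR ?nnegrE// ?ltW.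
Qed.

Lemma weak_lr_decay : weak_lr r t.
Proof.
have c0 : 0 <= c by apply: le_trans (tc 0%N); rewrite mulr_ge0// powR_ge0.
apply: (@le_lt_trans _ _ c%:E); last exact: ltry.
apply: ub_ereal_sup => _ [e /= e0 <-].
pose m := Num.truncn (c / e `^ r).
have ce0 : 0 <= c / e `^ r by rewrite divr_ge0// powR_ge0.
have sub : [set n | e < t n] `<=` `I_m.
  by move=> n /= /ltW/(few e0); rewrite /m truncn_gt_nat.
have fin_I : finite_set [set n | e < t n].
  by apply: sub_finite_set sub _; exact: finite_II.
rewrite /counting asboolT// lee_fin -ler_pdivlMl ?powR_gt0// mulrC.
apply: (@le_trans _ _ m%:R); last by rewrite truncn_le.
by rewrite ler_nat; apply: geq_card_fset_set; exact: subset_card_le.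
Qed.

Lemma cvg_decay : t @ \oo --> (0 : R).
Proof.
apply/cvgrPdist_lt => e e0; near=> n.
rewrite sub0r normrN ger0_norm ?(ltW (t0 n))// ltNge; apply/negP => /(few e0).
apply/negP; rewrite -ltNge (@lt_trans _ _ n%:R)// ?ltr_nat//.
near: n; exact: nbhs_infty_gtr.
Unshelve. all: by end_near. Qed.

End WeakDecay.

Section Times.
Variables (R : realType) (N : nat) (r : R).
Hypotheses (N0 : (0 < N)%N) (r0 : 0 < r).

(** [base ^ k] is K^(2N) for K = 2^k. Block k consists of the indices with base^k <= n + 1 <
    base^(k+1), so [trunc_log] recovers k. Only its first K^(2N) times are tested against the
    estimate; the others fill the block. *)
Definition base : nat := (2 ^ (2 * N))%N.
(** The least nonnegative exponent with (2 N + 2 + 2 slack) r >= 2 N. *)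
Definition slack : R := Num.max 0 (N%:R / r - (N%:R + 1)).
(** The [l0] of block k, with the constant that keeps the focusing sets in the ball; [spacing] is
    the corresponding [ell], the inverse of the lattice step. *)
Definition inv_scale (k : nat) : R := 8 * base%:R * N%:R * ((2 ^+ k) `^ slack).
Definition spacing (k : nat) : R := ((2 ^+ k) ^+ N) ^+ 2 * 2 ^+ k * inv_scale k.

Definition times (n : nat) : R :=
  let k := trunc_log base n.+1 in
  (2 * base ^ k.+1 - n.+1)%N%:R / (2 * pi * spacing k ^+ 2).

Let base_gt1 : (1 < base)%N.
Proof. by rewrite /base -{1}(expn0 2) ltn_exp2l// muln_gt0. Qed.

Let base_pow k : (base ^ k)%N%:R = ((2 ^+ k) ^+ N) ^+ 2 :> R.
Proof. by rewrite /base -expnM natrX -!exprM; congr (_ ^+ _); ring. Qed.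

Let slack_ge0 : 0 <= slack. Proof. by rewrite le_max lexx. Qed.

Let two_ge1 k : 1 <= 2 ^+ k :> R. Proof. by rewrite exprn_ege1// ler1n. Qed.

Let two_gt0 k : 0 < 2 ^+ k :> R. Proof. exact: lt_le_trans (two_ge1 k). Qed.

Let scale0_gt0 : 0 < 8 * base%:R * N%:R :> R.
Proof. by rewrite !mulr_gt0// ltr0n// ltnW. Qed.

Let inv_scale_gt0 k : 0 < inv_scale k.
Proof. by rewrite mulr_gt0// powR_gt0. Qed.

Lemma inv_scale_ge k : 8 * base%:R * N%:R <= inv_scale k.
Proof.
rewrite /inv_scale -[leLHS]mulr1 ler_wpM2l ?(ltW scale0_gt0)//.
by rewrite -[leLHS](powRr0 (2 ^+ k)) ler_powR.
Qed.

Let spacing_gt0 k : 0 < spacing k.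
Proof. by rewrite /spacing mulr_gt0 ?inv_scale_gt0// mulr_gt0// !exprn_gt0. Qed.

Let den_gt0 k : 0 < 2 * pi * spacing k ^+ 2.
Proof. by rewrite mulr_gt0 ?exprn_gt0// mulr_gt0 ?pi_gt0. Qed.

Let spacingS k : 2 * base%:R * spacing k <= spacing k.+1.
Proof.
rewrite /spacing; apply: (@le_trans _ _ (((2 ^+ k.+1) ^+ N) ^+ 2 * 2 ^+ k.+1 * inv_scale k)).
  rewrite -!base_pow expnS natrM [in leRHS]exprS le_eqVlt; apply/orP; left; apply/eqP; ring.
rewrite ler_wpM2l ?mulr_ge0 ?exprn_ge0 ?sqr_ge0// /inv_scale ler_wpM2l ?(ltW scale0_gt0)//.
rewrite ge0_ler_powR ?nnegrE ?(ltW (two_gt0 _))//.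
by rewrite exprS ler_peMl ?(ltW (two_gt0 _))// ler1n.
Qed.

Let bounds n : (base ^ trunc_log base n.+1 <= n.+1 < base ^ (trunc_log base n.+1).+1)%N.
Proof. exact: trunc_log_bounds. Qed.

(** Inside a block the numerator drops by one. At a change of block it passes from at least
    base^(k+1) to less than 2 base^(k+2), while the squared spacing grows by at least (2 base)^2. *)
Let times_decr n : times n.+1 < times n.
Proof.
rewrite /times; have /andP[lo hi] := bounds n.
set k := trunc_log base n.+1 in lo hi *.
have hi2 : (n.+1 <= 2 * base ^ k.+1)%N.
  by rewrite (leq_trans (ltnW hi))// leq_pmull.
move: hi; rewrite leq_eqVlt => /orP[/eqP n2|hi].
  have -> : trunc_log base n.+2 = k.+1 by rewrite n2 trunc_expnK.
  have s2 : 4 * spacing k ^+ 2 * base%:R ^+ 2 <= spacing k.+1 ^+ 2.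
    rewrite [leLHS](_ : _ = (2 * base%:R * spacing k) ^+ 2); last by ring.
    by rewrite ler_sqr ?nnegrE ?mulr_ge0 ?(ltW (spacing_gt0 _)).
  rewrite ltr_pdivrMr//; apply: (@lt_le_trans _ _ ((2 * base ^ k.+2)%N%:R)).
    by rewrite ltr_nat ltn_subrL muln_gt0 expn_gt0 (ltnW base_gt1).
  have n3 : (base ^ k.+1 <= 2 * base ^ k.+1 - n.+1)%N.
    by rewrite leq_subRL// -n2 mul2n -addnn leq_add2r leqnSn.
  apply: (@le_trans _ _ ((base ^ k.+1)%N%:R / (2 * pi * spacing k ^+ 2) * (2 * pi *
      (4 * spacing k ^+ 2 * base%:R ^+ 2)))).
    rewrite [leRHS](_ : _ = (base ^ k.+1)%N%:R * base%:R * (4 * base%:R)).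
      rewrite [leLHS](_ : _ = (base ^ k.+1)%N%:R * base%:R * 2); last first.
        by rewrite (expnS _ k.+1) !natrM; ring.
      by rewrite ler_wpM2l ?mulr_ge0// -natrM ler_nat (leq_trans (n := 4))// leq_pmulr// ltnW.
    by move: (spacing k) (spacing_gt0 k) (@pi R) (@pi_gt0 R) => u u0 p p0; field;
        rewrite !gt_eqF.
  apply: ler_pM; rewrite ?divr_ge0 ?mulr_ge0 ?(ltW (den_gt0 k)) ?sqr_ge0 ?pi_ge0//.
    by rewrite ler_wpM2r ?invr_ge0 ?(ltW (den_gt0 k))// ler_nat.
  by rewrite ler_wpM2l ?mulr_ge0 ?pi_ge0.
have -> : trunc_log base n.+2 = k by apply: trunc_log_eq => //; rewrite hi andbT (leq_trans lo).
by rewrite ltr_pM2r ?invr_gt0// ltr_nat ltn_sub2l// (leq_trans (ltnW hi))// leq_pmull.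
Qed.

Let times_gt0 n : 0 < times n.
Proof.
rewrite divr_gt0// ltr0n subn_gt0; have /andP[_ hi] := bounds n.
by rewrite (leq_trans hi)// leq_pmull.
Qed.

Let powR_two k : (2 ^+ k) `^ (2 * N%:R + 2 + 2 * slack) =
  ((2 ^+ k) ^+ N) ^+ 2 * (2 ^+ k) ^+ 2 * ((2 ^+ k) `^ slack) ^+ 2 :> R.
Proof.
have k0 := two_gt0 k.
rewrite powRD ?(gt_eqF k0) ?implybT// powRD ?(gt_eqF k0) ?implybT// (mulrC _ slack) [_ `^
    (slack * 2)]powRrM.
rewrite !powR_mulrn ?powR_ge0 ?(ltW k0)//; congr (_ * _ * _).
by rewrite -natrM powR_mulrn ?(ltW k0)// mulnC exprM.
Qed.

Let times_le n : times n < (2 ^+ trunc_log base n.+1) `^ (- (2 * N%:R + 2 + 2 * slack)).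
Proof.
rewrite /times; set k := trunc_log _ _; rewrite powRN ltr_pdivrMr//.
apply: (@lt_le_trans _ _ ((2 * base ^ k.+1)%N%:R)).
  by rewrite ltr_nat ltn_subrL muln_gt0 expn_gt0 (ltnW base_gt1).
rewrite expnS !natrM base_pow powR_two /spacing /inv_scale.
have bD : base%:R <= (8 * base%:R * N%:R) ^+ 2 :> R.
  have b1 : 1 <= base%:R :> R by rewrite ler1n ltnW.
  have N1 : 1 <= N%:R :> R by rewrite ler1n.
  apply: (@le_trans _ _ (8 * base%:R * N%:R)); last first.
    by rewrite expr2 ler_peMr ?(ltW scale0_gt0)// !mulr_ege1// ler1n.
  by rewrite mulrAC ler_peMl// mulr_ege1// ler1n.
move: (8 * base%:R * N%:R) bD (2 ^+ k) (two_gt0 k) => D bD u u0.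
have u1 : 0 < u `^ slack by rewrite powR_gt0.
rewrite [leRHS](_ : _ = 2 * (pi * D ^+ 2 * (u ^+ N) ^+ 2)); last first.
  by move: (u `^ slack) u1 (u ^+ N) (exprn_gt0 N u0) (@pi R) => v v0 w w0 p; field;
      rewrite !gt_eqF.
rewrite ler_wpM2l// ler_wpM2r ?sqr_ge0//; apply: (le_trans bD).
by rewrite ler_peMl ?sqr_ge0// (le_trans _ (pi_ge2 R))// ler1n.
Qed.

Let times_lt1 n : times n < 1.
Proof.
apply: lt_le_trans (times_le n) _.
by rewrite -[leRHS](powRr0 (2 ^+ trunc_log base n.+1)) ler_powR// oppr_le0 !addr_ge0// mulr_ge0.
Qed.

(** In block k the index is at most base * K^(2N) and the time is below K^(- (2 N + 2 + 2 slack));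
    the choice of [slack] makes the powers of K cancel or decay. *)
Let times_decay n : times n `^ r * n.+1%:R <= base%:R.
Proof.
have /andP[lo hi] := bounds n.
have := times_le n; set k := trunc_log _ _ in lo hi * => tk.
apply: (@le_trans _ _ (((2 ^+ k) `^ (- (2 * N%:R + 2 + 2 * slack))) `^ r * (base%:R *
    (2 ^+ k) `^ (2 * N%:R)))).
  apply: ler_pM; [exact: powR_ge0|exact: ler0n| |].
    by rewrite ge0_ler_powR ?nnegrE ?powR_ge0 ?ltW.
  have -> : base%:R * (2 ^+ k) `^ (2 * N%:R) = (base ^ k.+1)%N%:R :> R.
    rewrite expnS natrM base_pow; congr (_ * _).
    by rewrite -natrM powR_mulrn ?ltW// mulnC exprM.
  by rewrite ler_nat; exact: ltnW.
rewrite mulrCA -powRrM -powRD; last by rewrite (gt_eqF (two_gt0 k)) implybT.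
rewrite -[leRHS]mulr1 ler_wpM2l// -[leRHS](powRr0 (2 ^+ k)) ler_powR//.
have : N%:R / r - (N%:R + 1) <= slack by rewrite le_max lexx orbT.
rewrite lerBlDr ler_pdivrMr// => h; lra.
Qed.

Lemma times_spec : [/\ decreasing_seq times, forall n, 0 < times n < 1,
  times @ \oo --> (0 : R) & weak_lr r times].
Proof.
split.
- exact/decreasing_seqP.
- by move=> n; rewrite times_gt0 times_lt1.
- exact: cvg_decay r0 times_gt0 times_decay.
- exact: weak_lr_decay r0 times_gt0 times_decay.
Qed.

Lemma times_block k d : (d < (2 ^ k) ^ (2 * N))%N ->
  exists n, times n = block_time N (2 ^ k) base (inv_scale k) d.
Proof.
have e : ((2 ^ k) ^ (2 * N) = base ^ k)%N by rewrite /base -!expnM mulnC.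
rewrite e => dk; exists (base ^ k + d).-1.
have n1 : (base ^ k + d).-1.+1 = (base ^ k + d)%N.
  by rewrite prednK// addn_gt0 expn_gt0 (ltnW base_gt1).
have tl : trunc_log base (base ^ k + d) = k.
  apply: trunc_log_eq => //;
      rewrite leq_addr/= expnS (@leq_trans (base ^ k + base ^ k)) ?ltn_add2l//.
  by rewrite addnn -mul2n leq_mul2r base_gt1 orbT.
rewrite /times n1 tl /block_time /block_num e subnDA expnS mulnA.
by rewrite /spacing natrX.
Qed.

End Times.

(** * Comparison of exponents and conclusion *)

Lemma powR_two_unbounded (R : realType) (e M : R) : 0 < e ->
  ~ forall k, (0 < k)%N -> (2 ^+ k) `^ e <= M.
Proof.
move=> e0 H.
have M0 : 0 <= M by apply: le_trans (H 1%N isT); exact: powR_ge0.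
have ub k : (0 < k)%N -> k%:R <= M `^ e^-1.
  move=> k0; apply: (@le_trans _ _ (2 ^+ k)).
    by rewrite -natrX ler_nat ltnW// ltn_expl.
  have {1}-> : 2 ^+ k = ((2 ^+ k) `^ e) `^ e^-1 :> R.
    by rewrite -powRrM divff ?lt0r_neq0// powRr1 ?exprn_ge0.
  by rewrite ge0_ler_powR ?nnegrE ?powR_ge0 ?invr_ge0 ?(ltW e0)// H.
have := ub (Num.truncn (M `^ e^-1)).+1 isT.
by rewrite leNgt truncnS_gt ?powR_ge0.
Qed.

(** For s > 0 this is s < N / (2 N + 2 + slack), whose right-hand side is N / (2 (N + 1)) when slack
    = 0, and N / (N + 1 + N / r), the other entry of the minimum, when slack = N / r - (N + 1). *)
Lemma exponent_lt (R : realType) (N : nat) (r s : R) : (0 < N)%N -> 0 < r ->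
  s < Num.min (r / ((N%:R + 1) / N%:R * r + 1)) (N%:R / (2 * (N%:R + 1))) ->
  (2 * N%:R + 2 + slack N r) * (2 * Num.max s 0) < 2 * N%:R.
Proof.
move=> N0 r0; rewrite lt_min => /andP[s1 s2].
have n0 : 0 < N%:R :> R by rewrite ltr0n.
rewrite /slack; move: (N%:R : R) n0 s1 s2 => n n0 s1 s2.
have p1 : 0 < (n + 1) / n * r + 1.
  by rewrite addr_gt0// mulr_gt0// divr_gt0// addr_gt0.
have [s0|s0] := lerP s 0; first by rewrite mulr0 mulr0 mulr_gt0.
have [h|h] := lerP 0 (n / r - (n + 1)).
  rewrite ltr_pdivlMr// in s1.
  rewrite [ltLHS](_ : _ = 2 * (n / r * (s * ((n + 1) / n * r + 1)))); last first.
    by field; rewrite !gt_eqF.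
  rewrite ltr_pM2l// [ltRHS](_ : _ = n / r * r); last by field; rewrite gt_eqF.
  by rewrite ltr_pM2l// divr_gt0.
rewrite ltr_pdivlMr ?mulr_gt0 ?addr_gt0// in s2.
by rewrite addr0; nra.
Qed.

Theorem theorem1p3 (R : realType) (N : nat) (hN : (2 <= N)%N)
    (r : R) (hr : 0 < r) :
  exists t : nat -> R,
    [/\ decreasing_seq t,
        forall n, 0 < t n < 1,
        t @ \oo --> (0 : R),
        weak_lr r t &
        forall s : R,
          s < Num.min (r / ((N%:R + 1) / N%:R * r + 1))
                      (N%:R / (2 * (N%:R + 1))) ->
          ~ exists C : R, maximal_estimate N t s C].
Proof.
have N0 : (0 < N)%N by apply: leq_trans hN.
have [t1 t2 t3 t4] := times_spec N0 hr.
exists (times N r); split => // s hs [C hC].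
have hexp := exponent_lt N0 hr hs.
(* For negative [s] the Sobolev norm is bounded by the L^2 norm, hence the exponent 0. *)
set s' := Num.max s 0 in hexp.
have s1 : s <= 1.
  move: hs; rewrite lt_min => /andP[_ /ltW hs]; apply: (le_trans hs).
  have n0 : 0 < N%:R :> R by rewrite ltr0n.
  rewrite ler_pdivrMr ?mulr_gt0 ?addr_gt0//; lra.
have b1 : (1 <= base N)%N by rewrite /base expn_gt0.
pose D : R := 8 * (base N)%:R * N%:R.
pose c : R := (4 * 80 * pi * (8 * (base N)%:R))^-1 ^+ N.
have D0 : 0 < D by rewrite !mulr_gt0 ?ltr0n.
have c0 : 0 < c by rewrite exprn_gt0// invr_gt0 !mulr_gt0 ?pi_gt0 ?ltr0n.
pose E : R := 2 * N%:R - (2 * N%:R + 2 + slack N r) * (2 * s').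
have E0 : 0 < E by rewrite subr_gt0.
(* For every K = 2^k > 1 the block gives c K^(2N) <= C^2 (2 pi D K^(2N+2+slack))^(2 s'), so K^E
   would be bounded although E > 0. *)
apply: (@powR_two_unbounded R E (c^-1 * (C ^+ 2 * (2 * pi * D) `^ (2 * s'))) E0) => k k0.
have K1 : (1 < 2 ^ k)%N by rewrite -{1}(expn0 2) ltn_exp2l.
have := block_lower_bound N0 K1 b1 (inv_scale_ge r N0 k) s1 (fun d =>
    @times_block R N r N0 k d) hC.
rewrite -/c -/s' natrX /inv_scale -/D.
set u : R := 2 ^+ k; have u0 : 0 < u by exact: exprn_gt0.
have -> : (u ^+ N) ^+ 2 = u `^ (2 * N%:R).
  by rewrite -natrM powR_mulrn ?(ltW u0)// mulnC exprM.
have -> : 2 * pi * (u `^ (2 * N%:R) * u ^+ 2 * (D * u `^ slack N r)) =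
    2 * pi * D * u `^ (2 * N%:R + 2 + slack N r).
  rewrite powRD ?(gt_eqF u0) ?implybT// powRD ?(gt_eqF u0) ?implybT//.
  by rewrite (powR_mulrn 2 (ltW u0)); ring.
have pD : 0 <= 2 * pi * D by rewrite !mulr_ge0 ?pi_ge0 ?(ltW D0).
rewrite powRM ?powR_ge0// -powRrM => H.
have -> : u `^ E = u `^ (2 * N%:R) / u `^ ((2 * N%:R + 2 + slack N r) * (2 * s')).
  by rewrite -powRN -powRD// (gt_eqF u0) implybT.
rewrite ler_pdivrMr ?powR_gt0// -[leRHS]mulrA ler_pdivlMl// -[leRHS]mulrA.
exact: H.
Qed.
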